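(* Let $f,g$ be non-negative integers and $\mu\in\mathcal P_{f,g}$. Then in $M^{(f,g)}$, \[s_\mu m=\sum_{\lambda\in\mathcal P_{f,g}}(-1)^{|\lambda|+|\mu|}\mathrm e_{\lambda\mu}\,t_\lambda m.\]
   Context: $\mathbb F$ is any field, $k=f+g$, $\mathfrak S_k$ has Coxeter generators $t_i=(i\ i{+}1)$ and $s_i=t_i-1\in\mathbb F\mathfrak S_k$. $M^{(f,g)}=\langle m\mid t_im=m\ (i\ne f)\rangle$ as an $\mathbb F\mathfrak S_k$-module. $\mathcal P_{f,g}$ is the set of partitions $\lambda$ with at most $g$ nonzero parts, all at most $f$. For $\lambda\in\mathcal P_{f,g}$, $t_\lambda=\prod_{r=1}^{g}(t_{\lambda_r+g-r+1}t_{\lambda_r+g-r+2}\cdots t_{f+g-r})$, the product taken with $r=1$ leftmost (each factor empty if $\lambda_r=f$), and $s_\lambda$ is defined by the same formula with each $t_i$ replaced by $s_i$. Partitions are identified with Young diagrams $\{(a,b)\in\mathbb N^2:b\le\lambda_a\}$; nodes are elements of $\mathbb N^2$; $(a,b)$ has height $a+b$ and lies in column $b-a$ (smaller column = further left). $\mathtt{NE}(\mathfrak n)=\mathfrak n+(0,1)$, $\mathtt{SW}(\mathfrak n)=\mathfrak n-(0,1)$, $\mathtt{SE}(\mathfrak n)=\mathfrak n-(1,0)$. A tile is a finite nonempty set of nodes orderable $\mathfrak n_1,\dots,\mathfrak n_r$ with $\mathfrak n_{i+1}\in\{\mathtt{NE}(\mathfrak n_i),\mathtt{SE}(\mathfrak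 n_i)\}$; start = leftmost node, end = rightmost node; Dyck tile if start and end both attain the maximal height of its nodes. A Dyck tiling of $\lambda\setminus\mu$ ($\lambda\supseteq\mu$) is a partition of it into Dyck tiles; it is cover-expansive if whenever $\mathfrak a,\mathtt{SE}(\mathfrak a)\in\lambda\setminus\mu$, the tile of $\mathtt{SE}(\mathfrak a)$ starts weakly left of the start of the tile of $\mathfrak a$, and whenever $\mathfrak a,\mathtt{SW}(\mathfrak a)\in\lambda\setminus\mu$, the tile of $\mathtt{SW}(\mathfrak a)$ ends weakly right of the end of the tile of $\mathfrak a$. $\mathrm e_{\lambda\mu}$ is the number of cover-expansive Dyck tilings of $\lambda\setminus\mu$ if $\lambda\supseteq\mu$, and $0$ otherwise. *)

(* Defs.v *)
From HB Require Import structures.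
From mathcomp Require Import all_boot all_order all_fingroup all_algebra.
Set Implicit Arguments. Unset Strict Implicit. Unset Printing Implicit Defensive.
Import Order.TTheory GRing.Theory Num.Theory.

(* Elements of F S_k are represented as {ffun 'S_k -> F} (coefficient vectors).   *)

Definition gmul (F : fieldType) (k : nat) (x y : {ffun 'S_k -> F}) : {ffun 'S_k -> F} :=
  [ffun s => (\sum_(h : 'S_k) x h * y (h^-1 * s)%g)%R].

Definition gscale (F : fieldType) (k : nat) (c : F) (x : {ffun 'S_k -> F}) : {ffun 'S_k -> F} :=
  [ffun s => (c * x s)%R].

Definition gelem (F : fieldType) (k : nat) (s : 'S_k) : {ffun 'S_k -> F} :=
  [ffun u => (((u == s)%:R)%R : F)].

(* Coxeter generator t_i = (i i+1) (1-based positions i, i+1, for 1 <= i < k);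
   positions are 'I_k, i.e. 0-based, so t_i swaps i-1 and i. *)
Definition tr (k : nat) (i : nat) : 'S_k :=
  match @insub _ (fun j => j < k) 'I_k i.-1, @insub _ (fun j => j < k) 'I_k i with
  | Some a, Some b => tperm a b
  | _, _ => 1%g
  end.

Definition tgen (F : fieldType) (k i : nat) : {ffun 'S_k -> F} := gelem F (tr k i).
Definition sgen (F : fieldType) (k i : nat) : {ffun 'S_k -> F} :=
  (tgen F k i - gelem F 1%g)%R.

(* x . m = 0 in M^(f,g) = F S_k / (left ideal generated by t_i - 1, i <> f),
   i.e. x lies in the left ideal generated by the s_i, 1 <= i < k, i <> f. *)
Definition kills_m (F : fieldType) (f g : nat) (x : {ffun 'S_(f + g) -> F}) : Prop :=
  exists a : nat -> {ffun 'S_(f + g) -> F},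
    x = (\sum_(1 <= i < f + g | i != f) gmul (a i) (sgen F (f + g) i))%R.

(* A partition with at most g nonzero parts, all <= f, is stored as the
   g-tuple (lambda_1, ..., lambda_g) (padded with zeros), nonincreasing. *)
Definition is_part (f g : nat) (l : g.-tuple 'I_f.+1) : bool :=
  sorted (fun x y : 'I_f.+1 => (y <= x)%N) l.

(* lambda_{r+1}, with 0-based r *)
Definition part (f g : nat) (l : g.-tuple 'I_f.+1) (r : nat) : nat :=
  nth 0 [seq val x | x <- l] r.

Definition psize (f g : nat) (l : g.-tuple 'I_f.+1) : nat := \sum_(x <- l) val x.

(* t_lambda = prod_{r=1}^g (t_{lambda_r+g-r+1} ... t_{f+g-r}), r = 1 leftmost.
   With 0-based r' = r-1 the factor indices run over lambda_{r'+1}+g-r' <= i < f+g-r'. *)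
Definition tword (F : fieldType) (f g : nat) (l : g.-tuple 'I_f.+1) : {ffun 'S_(f + g) -> F} :=
  \big[@gmul F (f + g) / gelem F 1%g]_(r < g)
     \big[@gmul F (f + g) / gelem F 1%g]_(part l r + g - r <= i < f + g - r)
        tgen F (f + g) i.

Definition sword (F : fieldType) (f g : nat) (l : g.-tuple 'I_f.+1) : {ffun 'S_(f + g) -> F} :=
  \big[@gmul F (f + g) / gelem F 1%g]_(r < g)
     \big[@gmul F (f + g) / gelem F 1%g]_(part l r + g - r <= i < f + g - r)
        sgen F (f + g) i.

(* Nodes (a,b) in N^2 (a, b >= 1); all nodes of diagrams in P_{f,g} satisfy
   a <= g, b <= f, so we work in the finite box 'I_g.+1 * 'I_f.+1. *)
Notation node f g := ('I_g.+1 * 'I_f.+1)%type.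

Definition height (f g : nat) (x : node f g) : nat := (x.1 + x.2)%N.
Definition col (f g : nat) (x : node f g) : int := (x.2%:Z - x.1%:Z)%R.

Definition isNE (f g : nat) (x y : node f g) : bool :=
  (val y.1 == val x.1) && (val y.2 == (val x.2).+1).
Definition isSE (f g : nat) (x y : node f g) : bool :=
  ((val y.1).+1 == val x.1) && (val y.2 == val x.2).
Definition isSW (f g : nat) (x y : node f g) : bool :=
  (val y.1 == val x.1) && ((val y.2).+1 == val x.2).

Definition is_tile (f g : nat) (S : {set node f g}) : bool :=
  (0 < #|S|)%N &&
  [exists s : (#|S|).-tuple (node f g),
     sorted (fun x y => isNE x y || isSE x y) s && (S == [set x in s])].

Definition is_start (f g : nat) (S : {set node f g}) (x : node f g) : bool :=
  (x \in S) && [forall y in S, (col x <= col y)%R].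
Definition is_end (f g : nat) (S : {set node f g}) (x : node f g) : bool :=
  (x \in S) && [forall y in S, (col y <= col x)%R].

Definition is_dyck (f g : nat) (S : {set node f g}) : bool :=
  [&& is_tile S,
      [forall x, is_start S x ==> [forall z in S, (height z <= height x)%N]] &
      [forall x, is_end S x ==> [forall z in S, (height z <= height x)%N]]].

Definition dyck_tiling (f g : nat) (T : {set {set node f g}}) (R : {set node f g}) : bool :=
  partition T R && [forall S in T, is_dyck S].

Definition cover_expansive (f g : nat) (T : {set {set node f g}}) (R : {set node f g}) : bool :=
  [forall a in R, forall b in R, isSE a b ==>
     [forall u, forall v, is_start (pblock T b) u ==> is_start (pblock T a) v ==>
        (col u <= col v)%R]] &&
  [forall a in R, forall b in R, isSW a b ==>
     [forall u, forall v, is_end (pblock T b) u ==> is_end (pblock T a) v ==>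
        (col v <= col u)%R]].

Definition diagram (f g : nat) (l : g.-tuple 'I_f.+1) : {set node f g} :=
  [set x : node f g | [&& (0 < x.1)%N, (0 < x.2)%N & (x.2 <= part l (x.1).-1)%N]].

Definition ecoef (f g : nat) (lam mu : g.-tuple 'I_f.+1) : nat :=
  if diagram mu \subset diagram lam then
    #|[set T : {set {set node f g}} |
         dyck_tiling T (diagram lam :\: diagram mu) &&
         cover_expansive T (diagram lam :\: diagram mu)]|
  else 0.

Arguments kills_m F f g x : clear implicits.

(* Main.v *)
Require Import Defs.
From HB Require Import structures.
From mathcomp Require Import all_boot all_order all_fingroup all_algebra.
From mathcomp Require Import zify.
Import Order.TTheory GRing.Theory Num.Theory.
Set Implicit Arguments. Unset Strict Implicit. Unset Printing Implicit Defensive.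

(* M^(f,g) is the permutation module on words with f letters [true] and g letters
   [false], and t_lambda m is the word of the boundary path of lambda. On M^(f,g)
   the s_i satisfy the Temperley-Lieb relations, so that s_mu m is read off the
   matching of the word of mu which pairs every [false] with the [true] closing it,
   as in a bracketing: it is the signed sum of all words obtained by exchanging the
   two letters of some of the matched pairs.

   On the tiling side, induction on the distance to mu shows that the tiles of a
   cover-expansive Dyck tiling are translates of pieces of the boundary path of mu,
   and the piece must join the two ends of a matched pair. Hence the tiling is
   determined by the set of pairs whose exchange turns mu into lambda: there is
   exactly one tiling if lambda is obtained from mu in this way, none otherwise. *)

(** * The group algebra and the module *)

(** Words and tilings are compared through one function, the number [tcount] of letters [true] read
    so far. In the coordinates [nx], [ny] the region between the two paths is
    [Tm (nx n) < ny n <= Tl (nx n)], and the level [ny n - Tm (nx n)] is what stays constant along a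
    tile. The tile of level [l] through a node occupies the maximal run of columns on which
    [Tl - Tm] is at least [l]; these runs grow as [l] decreases, and this nesting yields
    cover-expansiveness. Matched pairs enter because both ends of a Dyck tile have maximal height:
    [is_arc] imposes the same condition on the path of [mu]. Existence and uniqueness of the tiling
    thus become inequalities between counts. The quotient module is never built: an element is put
    into the left ideal by showing that all its coefficients on words vanish. *)

Section GroupAlgebra.
Variables (F : fieldType) (k : nat).
Implicit Types (x y z : {ffun 'S_k -> F}) (s t : 'S_k).

Lemma gmulA x y z : gmul (gmul x y) z = gmul x (gmul y z).
Proof.
apply/ffunP => s; rewrite !ffunE.
under eq_bigr => h _ do rewrite ffunE mulr_suml.
rewrite exchange_big /=; apply: eq_bigr => u _.
rewrite ffunE mulr_sumr (reindex_inj (mulgI u)) /=.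
by apply: eq_bigr => v _; rewrite mulKg invMg mulgA mulrA.
Qed.

Lemma gmul_elem t x s : gmul (gelem F t) x s = x (t^-1 * s)%g.
Proof.
rewrite ffunE (bigD1 t) //= big1 ?addr0 => [|h ht]; rewrite ffunE.
  by rewrite eqxx mul1r.
by rewrite (negPf ht) mul0r.
Qed.

Lemma gmul1x x : gmul (gelem F 1%g) x = x.
Proof. by apply/ffunP => s; rewrite gmul_elem invg1 mul1g. Qed.

Lemma gmulDl x y z : gmul (x + y)%R z = (gmul x z + gmul y z)%R.
Proof.
apply/ffunP => s; rewrite !ffunE -big_split; apply: eq_bigr => h _.
by rewrite ffunE mulrDl.
Qed.

Lemma gmulNl x y : gmul (- x)%R y = (- gmul x y)%R.
Proof.
apply/ffunP => s; rewrite !ffunE -sumrN; apply: eq_bigr => h _.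
by rewrite ffunE mulNr.
Qed.

Lemma gmulDr x y z : gmul x (y + z)%R = (gmul x y + gmul x z)%R.
Proof.
apply/ffunP => s; rewrite !ffunE -big_split; apply: eq_bigr => h _.
by rewrite ffunE mulrDr.
Qed.

Lemma gmulx0 x : gmul x 0%R = 0%R.
Proof. by apply/ffunP => s; rewrite !ffunE big1 // => h _; rewrite ffunE mulr0. Qed.

Lemma gmul_sumr (I : Type) (r : seq I) (P : pred I) x (E : I -> {ffun 'S_k -> F}) :
  gmul x (\sum_(i <- r | P i) E i)%R = (\sum_(i <- r | P i) gmul x (E i))%R.
Proof. exact: (big_morph _ (gmulDr x) (gmulx0 x)). Qed.

Lemma gscaleE (c : F) x : gscale c x = gmul (gscale c (gelem F 1%g)) x.
Proof.
apply/ffunP => s; rewrite !ffunE (bigD1 1%g) //= big1 ?addr0 => [|h h1].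
  by rewrite !ffunE eqxx mulr1 invg1 mul1g.
by rewrite !ffunE (negPf h1) mulr0 mul0r.
Qed.

Lemma gmul_elemM s t : gmul (gelem F s) (gelem F t) = gelem F (s * t)%g.
Proof.
apply/ffunP => u; rewrite gmul_elem !ffunE.
by rewrite -(inj_eq (mulgI s)) mulKVg.
Qed.

Lemma tr_tperm (a b : 'I_k) : b = a.+1 :> nat -> tr k b = tperm a b.
Proof. by move=> ab; rewrite /tr ab /= !valK -ab valK. Qed.

End GroupAlgebra.

(** * The left ideal annihilating [m], and coefficients on words *)

Section Kernel.
Variables (F : fieldType) (f g : nat).
Notation k := (f + g).
Implicit Types (x y z : {ffun 'S_k -> F}) (s t h : 'S_k).

Lemma kills_m0 : kills_m F f g 0%R.
Proof.
exists (fun=> 0%R); rewrite big1 // => i _; apply/ffunP => s.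
by rewrite !ffunE big1 // => h _; rewrite ffunE mul0r.
Qed.

Lemma kills_mD x y : kills_m F f g x -> kills_m F f g y -> kills_m F f g (x + y)%R.
Proof.
move=> [a ->] [b ->]; exists (fun i => (a i + b i)%R).
by rewrite -big_split; apply: eq_bigr => i _; rewrite gmulDl.
Qed.

Lemma kills_mMl x y : kills_m F f g y -> kills_m F f g (gmul x y).
Proof.
move=> [a ->]; exists (fun i => gmul x (a i)).
by rewrite gmul_sumr; apply: eq_bigr => i _; rewrite gmulA.
Qed.

Lemma kills_m_sum (I : finType) (E : I -> {ffun 'S_k -> F}) :
  (forall i, kills_m F f g (E i)) -> kills_m F f g (\sum_i E i)%R.
Proof. by move=> kE; elim/big_ind: _ => //; [exact: kills_m0 | exact: kills_mD]. Qed.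

Lemma kills_m_sgen i : 0 < i < k -> i != f -> kills_m F f g (sgen F k i).
Proof.
move=> /andP[i0 ik] i_f.
exists (fun j => if j == i then gelem F 1%g else 0%R).
rewrite (big_rem i) /=; last by rewrite mem_index_iota i0.
rewrite i_f eqxx gmul1x big1_seq ?addr0 // => j /andP[_].
rewrite mem_rem_uniq ?iota_uniq // inE => /andP[/negPf -> _].
by apply/ffunP => s; rewrite !ffunE big1 // => h _; rewrite ffunE mul0r.
Qed.

Definition fixes_m s : Prop := kills_m F f g (gelem F s - gelem F 1%g)%R.

Lemma fixes_m1 : fixes_m 1%g.
Proof. by rewrite /fixes_m subrr; exact: kills_m0. Qed.

Lemma fixes_mM s t : fixes_m s -> fixes_m t -> fixes_m (s * t)%g.
Proof.
move=> ks kt; rewrite /fixes_m.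
have -> : (gelem F (s * t)%g - gelem F 1%g =
   gmul (gelem F s) (gelem F t - gelem F 1%g) + (gelem F s - gelem F 1%g))%R.
  have gN x y : gmul x (- y)%R = (- gmul x y)%R.
    apply/eqP; rewrite -subr_eq0 opprK -gmulDr addrC subrr; apply/eqP; exact: gmulx0.
  by rewrite gmulDr gN !gmul_elemM mulg1 addrA subrK.
by apply: kills_mD => //; apply: kills_mMl.
Qed.

(** All points between [a] and [b] lie on the same side of [f], so conjugating by the transposition
    of [b.-1] and [b] shortens the distance without ever using the generator [t_f]. *)
Lemma fixes_m_tperm (a b : 'I_k) : a < b -> (a < f) = (b < f) -> fixes_m (tperm a b).
Proof.
move: {2}(b - a).-1 (leqnn (b - a).-1) => n.
elim: n a b => [|n IHn] a b hn ab hf.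
  have e : b = a.+1 :> nat by lia.
  rewrite /fixes_m -(tr_tperm e); apply: kills_m_sgen; first by rewrite ltn_ord andbT; lia.
  by apply/eqP => bf; rewrite bf in e hf; lia.
have [e|e] := eqVneq (nat_of_ord b) a.+1; first by apply: (IHn) => //; lia.
have hc : b.-1 < k by have := ltn_ord b; lia.
pose c := Ordinal hc.
have fcb : fixes_m (tperm c b) by apply: IHn; rewrite /=; lia.
have -> : tperm a b = (tperm c b * tperm a c * tperm c b)%g.
  have nac : a != c by apply/eqP => /(congr1 val) /=; lia.
  have nab : a != b by apply/eqP => /(congr1 val) /=; lia.
  have nE : (tperm a c ^ tperm c b = tperm a b)%g.
    by rewrite tpermJ tpermL tpermD // eq_sym.
  by rewrite -nE conjgE tpermV mulgA.
apply: fixes_mM => //; apply: fixes_mM => //; apply: IHn; rewrite /=; lia.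
Qed.

Lemma fixes_m_young s : (forall x : 'I_k, (s x < f) = (x < f)) -> fixes_m s.
Proof.
move: {2}#|_| (leqnn #|[set x | s x != x]|) => n.
elim: n s => [|n IHn] s hn hs.
  suff -> : s = 1%g by exact: fixes_m1.
  apply/permP => x; rewrite perm1; apply/eqP/negPn/negP => sx.
  by move: hn; rewrite leqn0 cards_eq0 => /eqP/setP/(_ x); rewrite !inE sx.
have [/eqP fx | [x]] := set_0Vmem [set x | s x != x].
  by apply: IHn => //; move/eqP: fx => ->; rewrite cards0.
rewrite inE => sx.
(* Composing with this transposition makes [x] a fixed point and moves no new point. *)
have -> : s = ((s * tperm (s x) x) * tperm (s x) x)%g.
  by rewrite -mulgA tperm2 mulg1.
apply: fixes_mM; last first.
  have [lt|lt|/val_inj e] := ltngtP (s x) x; last by rewrite e eqxx in sx.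
    by apply: fixes_m_tperm.
  by rewrite tpermC; apply: fixes_m_tperm.
apply: IHn => [|y]; last first.
  rewrite permM; case: tpermP => [/perm_inj -> //|e|_ _]; rewrite hs //.
  by rewrite -e hs.
rewrite -ltnS; apply: leq_trans hn; apply: proper_card; apply/properP; split.
  apply/subsetP => y; rewrite !inE permM; apply: contra => /eqP sy.
  rewrite sy; case: tpermP => // e; move: sx.
    by have -> : x = y; rewrite ?sy ?eqxx //; apply: (@perm_inj _ s); rewrite sy.
  by rewrite -e sy eqxx.
by exists x; rewrite !inE // permM tpermL eqxx.
Qed.

(* The coefficients of [x . m] in the basis of two-letter words, [M^(f,g)]
   being the permutation module on words with [f] letters [true] and [g]
   letters [false]; [m] is the word [true^f false^g]. *)
Definition wcoef x (l : nat -> bool) : F :=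
  (\sum_(h : 'S_k | [forall a : 'I_k, (h a < f)%N == l a]) x h)%R.

Definition word_of_perm h (a : nat) : bool :=
  if insub a is Some o then h (o : 'I_k) < f else false.

Lemma word_of_permE h (a : 'I_k) : word_of_perm h a = (h a < f).
Proof. by rewrite /word_of_perm valK. Qed.

Lemma gelem_word s t :
  (forall a : 'I_k, (s a < f) = (t a < f)) -> kills_m F f g (gelem F t - gelem F s)%R.
Proof.
move=> st.
have ky : fixes_m (s^-1 * t)%g.
  by apply: fixes_m_young => y; rewrite permM -st permKV.
have -> : (gelem F t - gelem F s = gmul (gelem F s) (gelem F (s^-1 * t)%g - gelem F 1%g))%R.
  apply/ffunP => u; rewrite gmul_elem !ffunE.
  by rewrite -!(inj_eq (mulgI s) (s^-1 * u)%g) !mulKVg mulg1.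
exact: kills_mMl.
Qed.

(** Replacing every permutation by a chosen representative of its word changes [x] by an element of
    the left ideal; what remains has the word coefficients of [x] as its coefficients, hence is
    zero. *)
Lemma kills_m_wcoef x : (forall h, wcoef x (word_of_perm h) = 0%R) -> kills_m F f g x.
Proof.
move=> hx.
pose cls h : {ffun 'I_k -> bool} := [ffun a => h a < f].
pose rep h : 'S_k := odflt h [pick u | cls u == cls h].
have repP h : cls (rep h) = cls h by rewrite /rep; case: pickP => //= u /eqP.
have repE h h' : cls h = cls h' -> rep h = rep h'.
  move=> e; rewrite /rep; under eq_pick => u do rewrite e.
  by case: pickP => //= /(_ h'); rewrite eqxx.
have x_sum : x = (\sum_h gscale (x h) (gelem F h))%R.
  apply/ffunP => s; rewrite sum_ffunE (bigD1 s) //= big1 ?addr0 => [|h hs].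
    by rewrite !ffunE eqxx mulr1.
  by rewrite !ffunE eq_sym (negPf hs) mulr0.
have rep_sum : (\sum_h gscale (x h) (gelem F (rep h)) = 0)%R.
  apply/ffunP => s; rewrite sum_ffunE [RHS]ffunE.
  have [/existsP[h0 /eqP h0s]|/existsPn no] := boolP [exists h, rep h == s]; last first.
    by apply: big1 => h _; rewrite !ffunE eq_sym (negPf (no h)) mulr0.
  apply: etrans (hx h0); rewrite /wcoef [RHS]big_mkcond /=; apply: eq_bigr => h _.
  rewrite !ffunE; have -> : (s == rep h) = [forall a : 'I_k, (h a < f) == word_of_perm h0 a].
    apply/eqP/forallP => [srep a | e].
      have := congr1 (fun c : {ffun 'I_k -> bool} => c a) (repP h).
      rewrite -srep -h0s repP !ffunE word_of_permE => ->; exact: eqxx.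
    rewrite -h0s; apply: repE; apply/ffunP => a; rewrite !ffunE.
    by rewrite (eqP (e a)) word_of_permE.
  by case: ifP; rewrite ?mulr1 ?mulr0.
rewrite x_sum -[X in kills_m _ _ _ X]subr0 -[X in (_ - X)%R]rep_sum -sumrB.
apply: kills_m_sum => h.
have -> : (gscale (x h) (gelem F h) - gscale (x h) (gelem F (rep h)) =
           gscale (x h) (gelem F h - gelem F (rep h)))%R.
  by apply/ffunP => s; rewrite !ffunE mulrBr.
rewrite gscaleE; apply: kills_mMl; apply: gelem_word => a.
by have := congr1 (fun c : {ffun 'I_k -> bool} => c a) (repP h); rewrite !ffunE.
Qed.

Lemma wcoefB x y l : wcoef (x - y)%R l = (wcoef x l - wcoef y l)%R.
Proof. by rewrite /wcoef -sumrB; apply: eq_bigr => h _; rewrite !ffunE. Qed.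

Lemma wcoefZ c x l : wcoef (gscale c x) l = (c * wcoef x l)%R.
Proof. by rewrite /wcoef mulr_sumr; apply: eq_bigr => h _; rewrite ffunE. Qed.

Lemma wcoef_sum (I : finType) (P : pred I) (E : I -> {ffun 'S_k -> F}) l :
  wcoef (\sum_(i | P i) E i)%R l = (\sum_(i | P i) wcoef (E i) l)%R.
Proof.
by rewrite /wcoef exchange_big /=; apply: eq_bigr => h _; rewrite sum_ffunE.
Qed.

Lemma eq_wcoef x (l1 l2 : nat -> bool) : (forall a, a < k -> l1 a = l2 a) ->
  wcoef x l1 = wcoef x l2.
Proof.
by move=> e; apply: eq_bigl => h; apply: eq_forallb => a; rewrite e.
Qed.

Definition swap (i a : nat) : nat :=
  if a == i.-1 then i else if a == i then i.-1 else a.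

(** A product [s * t] applies [s] first, so left multiplication by [t_i] permutes the positions of a
    word. *)
Lemma wcoef_tgen i x l : 0 < i < k ->
  wcoef (gmul (tgen F k i) x) l = wcoef x (l \o swap i).
Proof.
move=> /andP[i0 ik]; have ik1 : i.-1 < k by lia.
pose a := Ordinal ik1; pose b := Ordinal ik.
have trE : tr k i = tperm a b by apply: (@tr_tperm k a b) => /=; lia.
have swapE (c : 'I_k) : swap i c = tperm a b c :> nat.
  rewrite /swap; case: tpermP => [->|->|/eqP ca /eqP cb] /=; rewrite ?eqxx //.
    by case: eqP => //; lia.
  by move: ca cb; rewrite -!val_eqE /= => /negPf -> /negPf ->.
rewrite /wcoef (reindex_inj (mulgI (tr k i))) /=; apply: eq_big => [h|h _].
  apply/forallP/forallP => H c.
    by have := H (tperm a b c); rewrite permM trE tpermK swapE.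
  by have := H (tperm a b c); rewrite /= swapE tpermK permM trE.
by rewrite gmul_elem mulKg.
Qed.

Lemma wcoef_sgen i x l : 0 < i < k ->
  wcoef (gmul (sgen F k i) x) l = (wcoef x (l \o swap i) - wcoef x l)%R.
Proof. by move=> ik; rewrite gmulDl gmulNl gmul1x wcoefB wcoef_tgen. Qed.

Lemma wcoef1 l : wcoef (gelem F 1%g) l = ([forall a : 'I_k, (a < f)%N == l a]%:R)%R.
Proof.
rewrite /wcoef; under eq_bigr => h _ do rewrite ffunE.
rewrite big_mkcond (bigD1 1%g) //= big1 ?addr0 => [|h h1].
  under eq_forallb => a do rewrite perm1.
  by rewrite eqxx; case: ifP.
by rewrite (negPf h1); case: ifP.
Qed.

End Kernel.

(** * Words and matched pairs *)

(* Reads [n] letters of the words [m] and [l] from position [x] on. A letter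
   [false] of [m] opens an arc, a letter [true] closes the last open one; the
   stack holds the letters of [l] at the open positions. The test says that [l]
   is obtained from [m] by exchanging the two letters at the ends of some
   closed arcs. *)
Fixpoint flips (m l : nat -> bool) (n x : nat) (st : seq bool) : bool :=
  if n is n'.+1 then
    if m x then
      if st is c :: st' then (c != l x) && flips m l n' x.+1 st'
      else l x && flips m l n' x.+1 [::]
    else flips m l n' x.+1 (l x :: st)
  else all negb st.

Lemma eq_flips (m1 l1 m2 l2 : nat -> bool) n x st :
  (forall y, x <= y < x + n -> m1 y = m2 y /\ l1 y = l2 y) ->
  flips m1 l1 n x st = flips m2 l2 n x st.
Proof.
elim: n x st => [|n IHn] x st e //=.
have [-> ->] : m1 x = m2 x /\ l1 x = l2 x by apply: e; lia.
have IH s : flips m1 l1 n x.+1 s = flips m2 l2 n x.+1 s.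
  by apply: IHn => y hy; apply: e; lia.
by case: (m2 x); case: st => [|c st]; rewrite IH.
Qed.

(** An unmatched [true] has to meet [true] in [l], just as if it closed an arc holding [false]; and
    a [false] left at the end passes the final test. So the bottom of the stack may be padded. *)
Lemma flips_rcons m l n x st :
  flips m l n x (rcons st false) = flips m l n x st.
Proof.
elim: n x st => [|n IHn] x st /=; first by rewrite all_rcons.
case: (m x); last by rewrite -rcons_cons IHn.
case: st => [|c st] /=; last by rewrite IHn.
by rewrite -(IHn _ [::]); case: (l x).
Qed.

Lemma swap_id i a : a != i.-1 -> a != i -> swap i a = a.
Proof. by rewrite /swap => /negPf -> /negPf ->. Qed.
Lemma swapL i : swap i i.-1 = i.
Proof. by rewrite /swap eqxx. Qed.
Lemma swapR i : 0 < i -> swap i i = i.-1.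
Proof. by rewrite /swap eqxx; case: eqP => //; lia. Qed.

(* The relations [s_i s_j s_i = s_i] (for [j = i +- 1]) of the
   Temperley-Lieb algebra, in terms of arcs. *)
Lemma flips_swap (m l : nat -> bool) i n x st :
  0 < i -> x <= i.-1 -> i < x + n -> m i.-1 -> ~~ m i ->
  (if l i.-1 == l i then 0
   else flips m l n x st + flips m (l \o swap i) n x st)%N =
  flips (m \o swap i) l n x st :> nat.
Proof.
move=> i0; elim: n x st => [|n IHn] x st xi ixn mi1 mi; first by lia.
have [xi1|xi1] := eqVneq x i.-1; last first.
  have xi2 : x != i by lia.
  rewrite /= (swap_id xi1 xi2).
  have IH s := IHn x.+1 s ltac:(lia) ltac:(lia) mi1 mi.
  case: (m x); last exact: IH.
  case: st => [|c st].
    by case: (l x) => /=; [exact: IH | case: ifP].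
  by case: (c != l x) => /=; [exact: IH | case: ifP].
case: n IHn ixn => [|n] _ ixn; first by lia.
have x1 : x.+1 = i by lia.
rewrite /= x1 xi1 mi1 (negPf mi) swapL (swapR i0) mi1 (negPf mi) /=.
have e1 s : flips (m \o swap i) l n i.+1 s = flips m l n i.+1 s.
  by apply: eq_flips => y hy /=; rewrite swap_id //; apply/eqP; lia.
have e2 s : flips m (l \o swap i) n i.+1 s = flips m l n i.+1 s.
  by apply: eq_flips => y hy /=; rewrite swap_id //; apply/eqP; lia.
rewrite !e1 ?e2 ?swapL ?(swapR i0).
(* Of the two words, exactly one has at [i.-1] the letter different from the top [c]; the letter it
   pushes at [i] is then [c] again, which restores the stack. An empty stack behaves as
   [c = false]. *)
case: st => [|c st] /=.
  rewrite -(flips_rcons m l n i.+1 [::]) /=.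
  by case: (l i.-1); case: (l i) => //=; rewrite ?addn0.
by case: (l i.-1); case: (l i); case: c => //=; rewrite ?addn0 ?e2.
Qed.

(* The parity of this number is that of [psize] up to a constant. *)
Definition fsum (k : nat) (l : nat -> bool) : nat := \sum_(x < k | ~~ l x) x.

Lemma eq_fsum k l1 l2 : (forall a, a < k -> l1 a = l2 a) -> fsum k l1 = fsum k l2.
Proof. by move=> e; apply: eq_bigl => a; rewrite e. Qed.

Lemma odd_fsum_swap k l i : 0 < i < k -> l i.-1 != l i ->
  odd (fsum k (l \o swap i)) = ~~ odd (fsum k l).
Proof.
move=> /andP[i0 ik] li.
have ik1 : i.-1 < k by lia.
pose a := Ordinal ik1; pose b := Ordinal ik.
have ba : b != a by rewrite -val_eqE /=; apply/eqP; lia.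
have E w : fsum k w = (if ~~ w i.-1 then i.-1 else 0) + ((if ~~ w i then i else 0) +
    \sum_(c < k | (c != a) && (c != b)) (if ~~ w c then (c : nat) else 0)).
  by rewrite /fsum big_mkcond (bigD1 a) //= (bigD1 b).
rewrite !E /= swapL swapR //.
set S1 := \sum_(_ < _ | _) _; set S2 := \sum_(_ < _ | _) _.
have -> : S1 = S2 by apply: eq_bigr => c /andP[ca cb]; rewrite swap_id.
have oi : odd i = ~~ odd i.-1 by rewrite -{1}(prednK i0).
by move: li; case: (l i.-1); case: (l i) => //= _; rewrite !oddD /= ?oi;
  case: (odd _); case: (odd S2).
Qed.

(** * Words of partitions *)

Definition parts_in_box (f g : nat) (p : nat -> nat) : Prop :=
  (forall r s, r <= s < g -> p s <= p r) /\ (forall r, r < g -> p r <= f).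

(* The boundary path of a partition, read from the bottom left corner of the
   [g] by [f] box: [true] is a step to the next column, [false] a step to the
   previous row. *)
Definition pword (g : nat) (p : nat -> nat) (x : nat) : bool :=
  [forall r : 'I_g, x != p r + (g - r.+1)].

Definition tcount (w : nat -> bool) (x : nat) : nat := \sum_(y < x) w y.

Lemma tcountS w x : tcount w x.+1 = tcount w x + w x.
Proof. by rewrite /tcount big_ord_recr. Qed.

Lemma tcount_le w x y : x <= y -> tcount w x <= tcount w y <= tcount w x + (y - x).
Proof.
elim: y => [|y IHy] xy; first by move: xy; rewrite leqn0 => /eqP ->; rewrite leqnn leq_addr.
have [->|xy'] := eqVneq x y.+1; first by rewrite leqnn leq_addr.
have := IHy ltac:(lia); rewrite tcountS; case: (w y); lia.
Qed.

Lemma eq_tcount w1 w2 x : (forall y, y < x -> w1 y = w2 y) -> tcount w1 x = tcount w2 x.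
Proof. by move=> e; apply: eq_bigr => y _; rewrite e. Qed.

Section PartitionWords.
Variables (f g : nat) (p : nat -> nat).
Hypothesis pP : parts_in_box f g p.

Lemma pword_pos r : r < g -> pword g p (p r + (g - r.+1)) = false.
Proof. by move=> rg; apply/negbTE/forallPn; exists (Ordinal rg); rewrite negbK /=. Qed.

Lemma pword_posP x : ~~ pword g p x -> exists2 r, r < g & x = p r + (g - r.+1).
Proof. by move=> /forallPn[r]; rewrite negbK => /eqP ->; exists r. Qed.

Lemma pos_decr r s : r < s < g -> p s + (g - s.+1) < p r + (g - r.+1).
Proof. by move=> rs; have := pP.1 r s ltac:(lia); lia. Qed.

Lemma pos_inj r s : r < g -> s < g ->
  p r + (g - r.+1) = p s + (g - s.+1) -> r = s.
Proof.
move=> rg sg e; have [rs|rs|//] := ltngtP r s.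
  by have := @pos_decr r s ltac:(lia); lia.
by have := @pos_decr s r ltac:(lia); lia.
Qed.

(** Each [false] position comes from exactly one row, so sums over rows turn into sums over
    positions. *)
Lemma pword_sum (h : nat -> nat) x :
  \sum_(r < g) (if p r + (g - r.+1) == x then h x else 0) = if pword g p x then 0 else h x.
Proof.
case: ifPn => [/forallP xw|/pword_posP[r rg ->]].
  by rewrite big1 // => r _; rewrite eq_sym (negPf (xw r)).
rewrite (bigD1 (Ordinal rg)) //= eqxx big1 ?addn0 // => s.
rewrite -val_eqE /= => sr; case: eqP => // /pos_inj e.
by case/eqP: sr; apply: e.
Qed.

Lemma tcount_pword x :
  tcount (pword g p) x + \sum_(r < g) (p r + (g - r.+1) < x) = x.
Proof.
elim: x => [|x IHx].
  by rewrite /tcount big_ord0 big1 // => r _; rewrite ltn0.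
have -> : \sum_(r < g) (p r + (g - r.+1) < x.+1) =
    \sum_(r < g) (p r + (g - r.+1) < x) + ~~ pword g p x.
  have -> : nat_of_bool (~~ pword g p x) = if pword g p x then 0 else 1.
    by case: (pword g p x).
  rewrite -(pword_sum (fun=> 1)) -big_split /=; apply: eq_bigr => r _.
  by case: eqP; case: ltnP; case: ltnP => //=; lia.
rewrite tcountS addnACA IHx.
by case: (pword g p x); rewrite addn1.
Qed.

(** The node [(a,b)] lies in shifted column [b + g - a]. If it belongs to the diagram, the first [a]
    rows end at or after this position, so at most [g - a] letters [false] precede it; otherwise
    more than [g - a] do. *)
Lemma diagram_tcount a b : 0 < a <= g ->
  (b <= p a.-1) = (b <= tcount (pword g p) (b + g - a)).
Proof.
move=> ag; have := tcount_pword (b + g - a).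
rewrite -(big_mkord xpredT (fun r => nat_of_bool (p r + (g - r.+1) < b + g - a))).
have [bp|bp] := leqP b (p a.-1).
  rewrite (@big_cat_nat _ _ _ a) //=; try lia.
  rewrite (@big_nat_cond _ _ _ 0 a) big1 ?add0n => [|r]; last first.
    by rewrite andbT => ra; have := pP.1 r a.-1 ltac:(lia); case: ltnP => //; lia.
  have : \sum_(a <= r < g) (p r + (g - r.+1) < b + g - a) <= g - a.
    rewrite -[g - a]muln1 -sum_nat_const_nat; apply: leq_sum => r _.
    by case: (_ < _).
  by move=> ? ?; apply/esym; lia.
rewrite (@big_cat_nat _ _ _ a.-1) //=; try lia.
rewrite [X in _ + (_ + X)](_ : _ = g - a.-1); last first.
  rewrite -[RHS]muln1 -sum_nat_const_nat; apply: eq_big_nat => r ra.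
  by have := pP.1 a.-1 r ltac:(lia); case: ltnP => //; lia.
by move=> ?; apply/esym/negbTE; lia.
Qed.

Lemma tcount_pword_end : tcount (pword g p) (f + g) = f.
Proof.
have := tcount_pword (f + g); rewrite (eq_bigr (fun=> 1)) => [|r _].
  by rewrite sum_nat_const card_ord muln1; lia.
by have := pP.2 r (ltn_ord r); have := ltn_ord r; case: ltnP => //; lia.
Qed.

Lemma fsum_pword : fsum (f + g) (pword g p) = \sum_(r < g) p r + \sum_(r < g) (g - r.+1).
Proof.
rewrite /fsum big_mkcond /=.
under eq_bigr => x _ do rewrite if_neg -(pword_sum id).
rewrite exchange_big -big_split /=; apply: eq_bigr => r _.
have hr : p r + (g - r.+1) < f + g.
  by have := pP.2 r (ltn_ord r); have := ltn_ord r; lia.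
rewrite (bigD1 (Ordinal hr)) //= eqxx big1 ?addn0 // => x.
by rewrite -val_eqE /= eq_sym => /negPf ->.
Qed.

End PartitionWords.

Lemma pword_inj f g p q : parts_in_box f g p -> parts_in_box f g q ->
  (forall x, x < f + g -> pword g p x = pword g q x) -> forall r, r < g -> p r = q r.
Proof.
move=> pP qP e r rg.
have H b : b <= f -> (b <= p r) = (b <= q r).
  move=> bf; rewrite (diagram_tcount pP _ (a := r.+1)) //.
  rewrite (diagram_tcount qP _ (a := r.+1)) //.
  by rewrite (@eq_tcount _ (pword g q)) // => y hy; apply: e; lia.
have := H (p r) (pP.2 r rg); have := H (q r) (qP.2 r rg); rewrite !leqnn; lia.
Qed.

Lemma pword_full f g x : x < f + g -> pword g (fun=> f) x = (x < f).
Proof.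
move=> xk; apply/forallP/idP => [H|xf r]; last by apply/eqP; lia.
rewrite ltnNge; apply/negP => fx.
have hr : g - (x - f).+1 < g by lia.
by have := H (Ordinal hr) => /=; lia.
Qed.

(** * Removing one box from a partition *)

Definition rem_box (p : nat -> nat) (j : nat) (r : nat) : nat :=
  if r == j then (p j).-1 else p r.

Section RemBox.
Variables (f g : nat) (p : nat -> nat) (j : nat).
Hypotheses (pP : parts_in_box f g p) (qP : parts_in_box f g (rem_box p j)).
Hypotheses (jg : j < g) (pj : 0 < p j).
Let i := p j + (g - j.+1).

Lemma pword_rem_boxL : pword g p i.-1.
Proof.
apply/forallP => r; apply/eqP; rewrite /i => e.
have [rj|rj|rj] := ltngtP r j; last by rewrite rj in e; lia.
  by have := pos_decr pP (r := r) (s := j) ltac:(lia); lia.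
(* A [false] just before [i] would come from a lower row at least as long as row [j], and shortening
   row [j] would not leave a partition. *)
have := qP.1 j r; rewrite /rem_box eqxx; case: eqP => [|_]; first by lia.
by have := ltn_ord r; lia.
Qed.

Lemma pword_rem_boxR : pword g p i = false.
Proof. exact: pword_pos. Qed.

Lemma pword_rem_box : pword g (rem_box p j) =1 pword g p \o swap i.
Proof.
move=> x /=; have i0 : 0 < i by rewrite /i; lia.
have [->|xi1] := eqVneq x i.-1.
  rewrite swapL pword_rem_boxR.
  have := pword_pos (rem_box p j) jg; rewrite {2}/rem_box eqxx => <-.
  by congr (pword _ _ _); rewrite /i; lia.
have [->|xi] := eqVneq x i.
  rewrite swapR // pword_rem_boxL; apply/forallP => r; apply/eqP; rewrite /rem_box.
  case: eqP => rj; rewrite /i; first by rewrite rj; lia.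
  by move=> /(pos_inj pP jg (ltn_ord r)) e; case: rj.
rewrite swap_id //; apply: eq_forallb => r; rewrite /rem_box.
case: (nat_of_ord r =P j) => // ->; transitivity true; [apply/eqP|apply/esym/eqP]; rewrite /i in xi xi1; lia.
Qed.

End RemBox.

Section BoxRemoval.
Variables (F : fieldType) (f g : nat).
Notation k := (f + g).
Variable G : nat -> {ffun 'S_k -> F}.
Variable Inv : (nat -> nat) -> {ffun 'S_k -> F} -> Prop.
Hypothesis Inv_ext : forall p q X,
  (forall r, r < g -> p r = q r) -> Inv p X -> Inv q X.
Hypothesis Inv_full : Inv (fun=> f) (gelem F 1%g).
Hypothesis Inv_rem : forall p j X, parts_in_box f g p ->
  parts_in_box f g (rem_box p j) -> j < g -> 0 < p j ->
  Inv p X -> Inv (rem_box p j) (gmul (G (p j + (g - j.+1))) X).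

(** Read from right to left, the product removes boxes from the full rectangle: rows from the last
    to the first, each from its right end. The index of a factor is the position of the [false] of
    the row being cut. [G] and [Inv] are abstract so as to serve both the [t] and the [s] words. *)
Lemma box_removal_ind p : parts_in_box f g p ->
  Inv p (\big[@gmul F k / gelem F 1%g]_(r < g)
     \big[@gmul F k / gelem F 1%g]_(p r + g - r <= i < f + g - r) G i).
Proof.
move=> pP.
pose fac r := \big[@gmul F k / gelem F 1%g]_(p r + g - r <= i < f + g - r) G i.
rewrite -(big_mkord xpredT fac).
suff H n : n <= g -> Inv (fun r => if r < g - n then f else p r)
    (\big[@gmul F k / gelem F 1%g]_(g - n <= r < g) fac r).
  have := H g (leqnn g); rewrite subnn; apply: Inv_ext => r _.
  by rewrite ltn0.
elim: n => [|n IHn] ng.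
  by rewrite subn0 big_geq //; apply: Inv_ext Inv_full => r ->.
have IH := IHn ltac:(lia); move: IH.
set j := g - n.+1; have -> : g - n = j.+1 by rewrite /j; lia.
have jg : j < g by rewrite /j; lia.
rewrite (@big_ltn _ _ _ j g) //; set Y := \big[_/_]_(j.+1 <= r < g) _ => IH.
(* The shape while row [j] is being cut: earlier rows still full, row [j] of length [c], later rows
   final. *)
pose st c r := if r < j then f else if r == j then c else p r.
have stP c : p j <= c <= f -> parts_in_box f g (st c).
  move=> hc; split=> [r s rs|r rg]; rewrite /st; last first.
    by have := pP.2 r rg; case: ltngtP; lia.
  have := pP.1 r s rs; have := pP.2 s ltac:(lia).
  case: (ltngtP r j) => rj; case: (ltngtP s j) => sj; try lia.
  by have := pP.1 j s ltac:(lia); lia.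
suff D d : d <= f - p j -> Inv (st (f - d))
    (gmul (\big[@gmul F k / gelem F 1%g]_(f - d + g - j <= i < f + g - j) G i) Y).
  have := D _ (leqnn _); have -> : f - (f - p j) = p j by have := pP.2 j jg; lia.
  by apply: Inv_ext => r _; rewrite /st; case: ltngtP => // ->.
elim: d => [|d IHd] hd.
  rewrite subn0 big_geq // gmul1x; apply: Inv_ext IH => r _.
  by rewrite /st ltnS; case: ltngtP.
rewrite (@big_ltn _ _ _ (f - d.+1 + g - j)); last by lia.
rewrite gmulA; have -> : (f - d.+1 + g - j).+1 = f - d + g - j by lia.
have -> : f - d.+1 + g - j = st (f - d) j + (g - j.+1).
  by rewrite /st ltnn eqxx; lia.
have E r : rem_box (st (f - d)) j r = st (f - d.+1) r.
  by rewrite /rem_box /st ltnn eqxx; case: ltngtP => //; lia.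
apply: (@Inv_ext (rem_box (st (f - d)) j)) => [r _|]; first exact: E.
apply: Inv_rem => //; last by apply: IHd; lia.
- by apply: stP; lia.
- have [H1 H2] := stP (f - d.+1) ltac:(lia).
  by split=> [r s rs|r rg]; rewrite !E; [exact: H1 | exact: H2].
- by rewrite /st ltnn eqxx; lia.
Qed.

End BoxRemoval.

(** * Coefficients of the [t] and [s] words *)

Section WordCoefficients.
Variables (F : fieldType) (f g : nat).
Notation k := (f + g).

Lemma parts_of_tuple (l : g.-tuple 'I_f.+1) : is_part l -> parts_in_box f g (part l).
Proof.
move=> lP; have sz : size [seq val x | x <- l] = g by rewrite size_map size_tuple.
split=> [r s rs|r rg]; last first.
  by rewrite /part (nth_map ord0) ?size_tuple // -ltnS ltn_ord.
have srt : sorted geq [seq val x | x <- l] by rewrite sorted_map.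
have gt : transitive geq by move=> a b c /= ab bc; exact: leq_trans bc ab.
by apply: (sorted_leq_nth gt leqnn 0 srt); rewrite ?inE ?sz; lia.
Qed.

(** All letters [true] precede all letters [false], so no arc is ever closed and only the word
    itself is accepted. *)
Lemma flips_full (l : nat -> bool) n x st : (x < f -> st = [::]) ->
  x + n = k ->
  flips (pword g (fun=> f)) l n x st =
  all negb st && [forall a : 'I_k, (x <= a) ==> ((a < f) == l a)].
Proof.
elim: n x st => [|n IHn] x st hst xn /=.
  suff -> : [forall a : 'I_k, (x <= a) ==> ((a < f) == l a)] by rewrite andbT.
  by apply/forallP => a; have := ltn_ord a; case: leqP => //=; lia.
have xk : x < k by lia.
have -> : [forall a : 'I_k, (x <= a) ==> ((a < f) == l a)] =
  ((x < f) == l x) && [forall a : 'I_k, (x < a) ==> ((a < f) == l a)].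
  apply/forallP/andP => [H|[H1 /forallP H2] a].
    split; first by have := H (Ordinal xk); rewrite /= leqnn.
    by apply/forallP => a; apply/implyP => xa; apply: (implyP (H a)); lia.
  by have [->|xa] := eqVneq (nat_of_ord a) x; [rewrite leqnn | have := H2 a; rewrite ltn_neqAle eq_sym xa].
rewrite pword_full //; case: (ltnP x f) => xf.
  by rewrite (hst xf) IHn ?andTb //; try lia; case: (l x).
rewrite IHn; try lia.
by rewrite /=; case: (l x); rewrite /= ?andbF ?andbT.
Qed.

Lemma wcoef_tword (l : g.-tuple 'I_f.+1) w : is_part l ->
  wcoef (tword F l) w = ([forall a : 'I_k, pword g (part l) a == w a]%:R)%R.
Proof.
move=> /parts_of_tuple lP; move: w.
apply: (@box_removal_ind F f g _ (fun p X => forall w,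
  wcoef X w = ([forall a : 'I_k, pword g p a == w a]%:R)%R)) => // [p q X e H w | w |].
- rewrite H; congr (_%:R)%R; congr nat_of_bool; apply: eq_forallb => a.
  by congr (_ == _); apply: eq_forallb => r; rewrite e.
- rewrite wcoef1; congr (_%:R)%R; congr nat_of_bool; apply: eq_forallb => a.
  by rewrite pword_full.
- move=> p j X pP qP jg pj H w.
  have ik : 0 < p j + (g - j.+1) < k by have := pP.2 j jg; lia.
  rewrite wcoef_tgen // H; congr (_%:R)%R; congr nat_of_bool.
  set i := p j + (g - j.+1) in ik *.
  have swapK a : swap i (swap i a) = a.
    have [->|a1] := eqVneq a i.-1; first by rewrite swapL swapR //; lia.
    have [->|a2] := eqVneq a i; first by rewrite swapR ?swapL //; lia.
    by rewrite !swap_id.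
  have swapk a : a < k -> swap i a < k by rewrite /swap; do 2?case: eqP; lia.
  apply/forallP/forallP => H1 a.
    rewrite (pword_rem_box pP qP jg pj) /= -/i.
    by have := H1 (Ordinal (swapk a (ltn_ord a))); rewrite /= swapK.
  have := H1 (Ordinal (swapk a (ltn_ord a))).
  by rewrite (pword_rem_box pP qP jg pj) /= -/i swapK.
Qed.

(** Applying [s_i] takes the coefficient at [w \o swap i] minus that at [w]. If the letters of [w]
    at [i.-1] and [i] differ, these carry opposite signs and the difference becomes, up to sign, the
    sum in [flips_swap]; if they agree, both sides vanish. *)
Lemma wcoef_sword (l : g.-tuple 'I_f.+1) w : is_part l ->
  wcoef (sword F l) w =
  ((-1) ^+ (fsum k w + fsum k (pword g (part l))) *
    (flips (pword g (part l)) w k 0 [::])%:R)%R.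
Proof.
move=> /parts_of_tuple lP; move: w.
apply: (@box_removal_ind F f g _ (fun p X => forall w,
  wcoef X w = ((-1) ^+ (fsum k w + fsum k (pword g p)) *
    (flips (pword g p) w k 0 [::])%:R)%R)) => // [p q X e H w | w |].
- have e1 a : pword g p a = pword g q a by apply: eq_forallb => r; rewrite e.
  rewrite H (@eq_fsum _ (pword g p) (pword g q)) //.
  by rewrite (@eq_flips (pword g p) w (pword g q) w).
- rewrite wcoef1 flips_full // andTb.
  have -> : [forall a : 'I_k, (0 <= a) ==> ((a < f) == w a)] =
            [forall a : 'I_k, (a < f) == w a] by apply: eq_forallb.
  case: (boolP [forall a : 'I_k, _]) => [/forallP e|_]; last by rewrite mulr0.
  rewrite mulr1 (@eq_fsum _ w (pword g (fun=> f))).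
    by rewrite -signr_odd addnn odd_double.
  by move=> a ak; rewrite pword_full // (eqP (e (Ordinal ak))).
- move=> p j X pP qP jg pj H w.
  have ik : 0 < p j + (g - j.+1) < k by have := pP.2 j jg; lia.
  set i := p j + (g - j.+1) in ik *.
  have e1 := pword_rem_box pP qP jg pj; rewrite -/i in e1.
  have wi1 : pword g p i.-1 := pword_rem_boxL pP qP jg pj.
  have wi : pword g p i = false := pword_rem_boxR p jg.
  rewrite wcoef_sgen // !H.
  rewrite (@eq_fsum _ (pword g (rem_box p j)) (pword g p \o swap i)) //.
  rewrite (@eq_flips (pword g (rem_box p j)) w (pword g p \o swap i) w) //.
  rewrite -(@flips_swap (pword g p) w i); try lia.
  case: eqP => [wE|/eqP wE].
    have e2 a : (w \o swap i) a = w a.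
      rewrite /= /swap; case: eqP => [->|_]; first by [].
      by case: eqP => [->|_].
    rewrite (@eq_fsum _ (w \o swap i) w) //.
    rewrite (@eq_flips (pword g p) (w \o swap i) (pword g p) w) //.
    by rewrite subrr mulr0.
  have o1 := odd_fsum_swap ik wE.
  have o2 : odd (fsum k (pword g p \o swap i)) = ~~ odd (fsum k (pword g p)).
    by apply: odd_fsum_swap; rewrite // wi wi1.
  rewrite -signr_odd oddD o1 -[in X in (_ - X)%R]signr_odd oddD -[in RHS]signr_odd oddD o2.
  rewrite natrD mulrDr addrC.
  by do 2!case: (odd _); rewrite /= ?expr0 ?expr1 ?mulN1r ?mul1r ?opprK // addrC.
Qed.

Lemma partition_of_word (h : 'S_k) : exists2 l : g.-tuple 'I_f.+1, is_part l &
  forall a, a < k -> pword g (part l) a = word_of_perm h a.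
Proof.
set w := word_of_perm h.
pose P := [seq x <- iota 0 k | ~~ w x].
have szP : size P = g.
  rewrite size_filter -sum1_count -[X in iota _ X]subn0 big_mkord.
  rewrite sum1_card -[RHS](card_ord g) -(card_imset _ (@rshift_inj f g)).
  rewrite -(card_imset _ (@perm_inj _ h)); apply: eq_card => b; apply/imsetP/imsetP.
    move=> [a]; rewrite unfold_in /w word_of_permE -leqNgt => fa ->.
    have hb : h a - f < g by have := ltn_ord (h a); lia.
    by exists (Ordinal hb) => //; apply: val_inj => /=; lia.
  move=> [c _ ->]; exists (h^-1 (rshift f c))%g; last by rewrite permKV.
  by rewrite unfold_in /w word_of_permE permKV /= -leqNgt leq_addr.
pose q s := nth 0 P s.
have qS s t : s <= t < g -> q s + (t - s) <= q t.
  elim: t => [|t IHt] st; first by move: st; rewrite leqn0 => /andP[/eqP -> _]; rewrite addn0.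
  have [->|st'] := eqVneq s t.+1; first by lia.
  have : q t < q t.+1.
    apply: (sorted_ltn_nth ltn_trans); rewrite ?inE ?szP //; try lia.
    by apply: sorted_filter; [exact: ltn_trans | exact: iota_ltn_sorted].
  by have := IHt ltac:(lia); lia.
have qP s : s < g -> q s < k /\ ~~ w (q s).
  move=> sg; have : q s \in P by apply: mem_nth; rewrite szP.
  by rewrite mem_filter mem_iota add0n => /andP[-> /andP[_ ->]].
(* [q s] has exactly [s] letters [false] before it; what is left counts the letters [true] before
   it, which is the length of the row. *)
pose p r := q (g - r.+1) - (g - r.+1).
have qg s : s < g -> s <= q s <= f + s.
  move=> sg; have := qS 0 s ltac:(lia); have := qS s g.-1 ltac:(lia).
  by have [] := qP g.-1 ltac:(lia); lia.
have pf r : r < g -> p r < f.+1.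
  by move=> rg; rewrite /p; have := qg (g - r.+1) ltac:(lia); lia.
pose l : g.-tuple 'I_f.+1 := [tuple inord (p i) | i < g].
have lE r : r < g -> part l r = p r.
  move=> rg; rewrite /part (nth_map ord0) ?size_tuple //.
  have -> : nth ord0 l r = tnth l (Ordinal rg) by rewrite (tnth_nth ord0).
  by rewrite tnth_mktuple /= inordK // pf.
have lP : is_part l.
  rewrite /is_part; apply/(sortedP ord0) => i; rewrite size_tuple => ig.
  have := lE i ltac:(lia); have := lE i.+1 ig.
  rewrite /part !(nth_map ord0) ?size_tuple //; try lia.
  move=> -> ->; rewrite /p; have := qS (g - i.+2) (g - i.+1) ltac:(lia); lia.
exists l => // a ak; apply/idP/idP => H; last first.
  apply/forallP => r; apply/eqP => e; move: H; rewrite e lE //.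
  have [_] := qP (g - r.+1) ltac:(have := ltn_ord r; lia).
  rewrite /p subnK; first by rewrite -/w => /negbTE ->.
  by have := qg (g - r.+1) ltac:(have := ltn_ord r; lia); lia.
apply/negPn/negP => wa.
have aP : a \in P by rewrite mem_filter mem_iota wa /=.
have sg : index a P < g by rewrite -szP index_mem.
have rg : g - (index a P).+1 < g by lia.
have := forallP H (Ordinal rg); rewrite /= lE //.
have := qg _ sg; have : q (index a P) = a by rewrite /q nth_index.
rewrite /p; have -> : g - (g - (index a P).+1).+1 = index a P by lia.
by lia.
Qed.

End WordCoefficients.

(** * Arcs *)

Section Arcs.
Variables (k : nat) (m : nat -> bool).
Notation T := (tcount m).

(* The boundary path has height [2 * T x - x] (up to a constant) after [x]
   steps. *)
Definition lower (y x : nat) : Prop := 2 * T y + x <= 2 * T x + y.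

(** Vertices [i.+1] and [j] of the path have equal height and no vertex between them is higher. This
    is the Dyck condition for a tile in columns [i.+1] to [j]; the letters [i] and [j] are the steps
    into and out of this stretch. *)
Definition is_arc (i j : nat) : Prop :=
  [/\ i < j < k, m i = false, m j = true, lower j i.+1 & forall y, i < y <= j -> lower y j].

(** The step at [j] takes the path above the height of vertex [i.+1], which a longer arc from [i]
    forbids. *)
Lemma arc_injR i j j' : is_arc i j -> is_arc i j' -> j = j'.
Proof.
wlog jj' : j j' / j < j' => [W|] a1 a2.
  by have [lt|lt|//] := ltngtP j j'; [|apply/esym]; apply: W.
have [? _ mj H1 H2] := a1; have [? _ _ H1' H2'] := a2.
have := H2' j.+1 ltac:(lia); have := H2' i.+1 ltac:(lia); have := H2 i.+1 ltac:(lia).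
by move: H1 H1'; rewrite /lower (tcountS m j) mj; lia.
Qed.

Lemma arc_injL i i' j : is_arc i j -> is_arc i' j -> i = i'.
Proof.
wlog ii' : i i' / i < i' => [W|] a1 a2.
  by have [lt|lt|//] := ltngtP i i'; [|apply/esym]; apply: W.
have [? _ mj H1 H2] := a1; have [? mi' _ H1' H2'] := a2.
have := H2 i' ltac:(lia); have := H2' i'.+1 ltac:(lia).
by move: H1 H1'; rewrite /lower (tcountS m i') mi'; lia.
Qed.

(** The stack of [flips], with positions in place of the letters of [l]. *)
Fixpoint openpos (x : nat) : seq nat :=
  if x is y.+1 then (if m y then behead (openpos y) else y :: openpos y) else [::].

(** The top of the stack is the last vertex strictly higher than the present one, so that a [true]
    read at [x] closes the arc described by [is_arc]. An empty stack means that no earlier vertex is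
    higher. *)
Lemma openposP x :
  if openpos x is i :: s then
    [/\ i < x, m i = false, lower x i.+1, (forall y, i < y <= x -> lower y x) & s = openpos i]
  else forall y, y <= x -> lower y x.
Proof.
elim/ltn_ind: x => -[|x] IH /=; first by move=> y; rewrite leqn0 => /eqP ->; rewrite /lower.
case mx: (m x); last first.
  split=> //; first by rewrite /lower.
  by move=> y yx; have ->: y = x.+1; [lia | rewrite /lower].
have := IH x (ltnSn x); case: (openpos x) => [|i0 s0] /=.
  move=> H y yx; have [->|yx'] := eqVneq y x.+1; first by rewrite /lower.
  by have := H y ltac:(lia); rewrite /lower tcountS mx; lia.
move=> [i0x mi0 H1 H2 ->].
have := IH i0 ltac:(lia).
have S1 := tcountS m x; have S2 := tcountS m i0; rewrite mx in S1; rewrite mi0 in S2.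
have H3 := H2 i0.+1 ltac:(lia).
case: (openpos i0) => [|i s].
  move=> H y yx; have [->|yx'] := eqVneq y x.+1; first by rewrite /lower.
  have [yi|yi] := leqP y i0; first by have := H y yi; move: H1 H3; rewrite /lower; lia.
  by have := H2 y ltac:(lia); rewrite /lower; lia.
move=> [ii0 mi H4 H5 H6]; split=> //; first by lia.
  by move: H1 H3 H4; rewrite /lower; lia.
move=> y yx; have [->|yx'] := eqVneq y x.+1; first by rewrite /lower.
have [yi|yi] := leqP y i0.
  by have := H5 y ltac:(lia); move: H1 H3; rewrite /lower; lia.
by have := H2 y ltac:(lia); rewrite /lower; lia.
Qed.

Lemma openpos_arc i s x : x < k -> m x -> openpos x = i :: s -> is_arc i x.
Proof. by move=> xk mx e; have := openposP x; rewrite e => -[*]; split=> //; lia. Qed.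

Lemma arc_openpos i j : is_arc i j -> exists s, openpos j = i :: s.
Proof.
move=> [ij mi mj H1 H2]; have := openposP j; have S := tcountS m i; rewrite mi in S.
case: (openpos j) => [H|i' s [i'j mi' H1' H2' _]].
  by have := H i ltac:(lia); move: H1; rewrite /lower; lia.
suff -> : i' = i by exists s.
apply: (@arc_injL i' i j); split=> //; lia.
Qed.

Lemma mem_openpos x i : i \in openpos x ->
  [/\ i < x, m i = false & forall y, i < y <= x -> lower y i.+1].
Proof.
elim/ltn_ind: x i => x IH i; have := openposP x.
case: (openpos x) => // i0 s [i0x mi0 H1 H2 ->]; rewrite inE => /orP[/eqP ->|ii0].
  by split=> // y yx; have := H2 y yx; move: H1; rewrite /lower; lia.
have [ii mi H] := IH i0 i0x i ii0; split=> //; first by lia.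
move=> y yx; have [yi|yi] := leqP y i0; first by apply: H; lia.
have := H i0 ltac:(lia); have := H2 y ltac:(lia); have S := tcountS m i0; rewrite mi0 in S.
by move: H1; rewrite /lower; lia.
Qed.

Lemma open_or_arc i x : i < x <= k -> m i = false ->
  i \in openpos x \/ exists2 j, j < x & is_arc i j.
Proof.
move=> + mi; elim: x => // x IHx ix /=.
have [e|ix'] := eqVneq i x; first by rewrite -e mi; left; rewrite inE eqxx.
have [io|[j jx a]] := IHx ltac:(lia); last by right; exists j => //; lia.
case mx: (m x); last by left; rewrite inE io orbT.
case e: (openpos x) io => [|i0 s] //=; rewrite inE => /orP[/eqP ->|->]; last by left.
by right; exists x => //; apply: openpos_arc e; rewrite ?mx //; lia.
Qed.

Variable l : nat -> bool.

Definition compatible : Prop :=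
  (forall i, i < k -> m i = false -> l i = true -> exists2 j, is_arc i j & l j = false) /\
  (forall j, j < k -> m j = true -> l j = false -> exists2 i, is_arc i j & l i = true).

Lemma flips_openpos n x : x + n = k ->
  flips m l n x (map l (openpos x)) <->
  (forall j, x <= j < k -> m j ->
     if openpos j is i :: _ then l i != l j else l j) /\ all (negb \o l) (openpos k).
Proof.
elim: n x => [|n IHn] x xn.
  have -> : x = k by lia.
  rewrite /= all_map; split=> [->|[]//]; split=> // j; lia.
have := IHn x.+1 ltac:(lia); rewrite /=.
case mx: (m x); last first.
  move=> IH; rewrite IH; split=> -[H1 H2]; split=> // j jx mj; apply: H1 => //; last by lia.
  by have [xj|xj] := eqVneq x j; [rewrite -xj mx in mj | lia].
have E (P : nat -> Prop) : (forall j, x <= j < k -> m j -> P j) <->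
    P x /\ (forall j, x < j < k -> m j -> P j).
  split=> [H|[H1 H2] j jx mj]; last first.
    by have [<-//|xj] := eqVneq x j; apply: H2; lia.
  by split=> [|j jx mj]; apply: H => //; lia.
rewrite E; case: (openpos x) => [|i s] /= IH.
  by split=> [/andP[lx /IH[H1 H2]]|[[lx H1] H2]] //; rewrite lx; apply/IH.
by split=> [/andP[lx /IH[H1 H2]]|[[lx H1] H2]] //; rewrite lx; apply/IH.
Qed.

Lemma flipsP : flips m l k 0 [::] <-> compatible.
Proof.
rewrite -[[::]]/(map l (openpos 0)) flips_openpos //; split=> [[H1 H2]|[C1 C2]].
  split=> [i ik mi li|j jk mj lj].
    have [io|[j jk a]] := @open_or_arc i k ltac:(lia) mi.
      by have := allP H2 _ io; rewrite /= li.
    exists j => //; have [s e] := arc_openpos a; have [_ _ mj _ _] := a.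
    by have := H1 j jk mj; rewrite e li; case: (l j).
  have := H1 j jk mj; rewrite lj; case e: (openpos j) => [|i s] // li.
  by exists i; [apply: openpos_arc e | move: li; case: (l i)].
split=> [j jk mj|].
  have jk' : j < k by lia.
  case e: (openpos j) => [|i s].
    case lj: (l j) => //; have [i a _] := C2 j jk' mj lj.
    by have [s e'] := arc_openpos a; rewrite e' in e.
  have a := openpos_arc jk' mj e; have [ij mi _ _ _] := a.
  have ik : i < k by lia.
  case li: (l i).
    by have [j' a' lj'] := C1 i ik mi li; rewrite (arc_injR a a') lj'.
  case lj: (l j) => //; have [i' a' li'] := C2 j jk' mj lj.
  by rewrite (arc_injL a a') li' in li.
(* A position still open at the end has the path weakly below vertex [i.+1] ever after, whereas the
   step closing an arc from [i] would climb above it. *)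
apply/allP => i io /=; have [ik mi H] := mem_openpos io.
apply/negP => li; have [j [ij _ mj H1 H2] _] := C1 i ik mi li.
have := H j.+1 ltac:(lia); have S := tcountS m j; rewrite mj in S.
by have := H2 i.+1 ltac:(lia); rewrite /lower; lia.
Qed.

Section Compatible.
Hypothesis C : compatible.
Notation Tl := (tcount l).

Lemma compatible_arc i j : is_arc i j -> l i = ~~ l j.
Proof.
move=> a; have [ij mi mj _ _] := a.
case li: (l i).
  by have [j' a' lj'] := C.1 i ltac:(lia) mi li; rewrite (arc_injR a a') lj'.
case lj: (l j) => //; have [i' a' li'] := C.2 j ltac:(lia) mj lj.
by rewrite (arc_injL a a') li' in li.
Qed.

(** The stretch from [a] to [b] is a concatenation of complete arcs, and exchanging the ends of an
    arc keeps the number of [true] in it. The induction peels off the last arc. *)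
Lemma compatible_balanced a b : a <= b <= k -> lower b a ->
  (forall y, a <= y <= b -> lower y b) -> Tl a + T b = Tl b + T a.
Proof.
elim/ltn_ind: b a => -[|z] IH a ab Hba Hy; first by move: ab; rewrite leqn0 => /andP[/eqP ->].
have [->//|az] := eqVneq a z.+1.
have S := tcountS m z; have Hz := Hy z ltac:(lia); have Ha := Hy a ltac:(lia).
case mz: (m z) in S; last by move: Hz; rewrite /lower; lia.
have := openposP z; case e: (openpos z) => [|i s] H.
  by have := H a ltac:(lia); move: Ha Hba; rewrite /lower; lia.
have zk : z < k by lia.
have ai := openpos_arc zk mz e; have [iz mi _ H1 H2] := ai.
have Si := tcountS m i; rewrite mi in Si.
have H3 := H2 i.+1 ltac:(lia).
have ai' : a <= i.
  rewrite leqNgt; apply/negP => ia.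
  by have := H2 a ltac:(lia); move: Hba; rewrite /lower; lia.
have E1 : Tl a + T i = Tl i + T a.
  apply: IH; [lia|lia| |].
    by move: H1 H3 Hba Ha; rewrite /lower; lia.
  by move=> y ya; have := Hy y ltac:(lia); move: H1 H3; rewrite /lower; lia.
have E2 : Tl i.+1 + T z = Tl z + T i.+1 by apply: IH => //; lia.
have := compatible_arc ai; move: E1 E2.
by rewrite !tcountS mi mz; case: (l z) => /=; lia.
Qed.

(** Every [true] of [m] met here closes an arc opened after [a], and an exchange moves it to the
    earlier end. *)
Lemma compatible_mono a y : a <= y <= k -> (forall z, a <= z <= y -> lower z a) ->
  Tl a + T y <= Tl y + T a.
Proof.
elim/ltn_ind: y => -[|z] IH ay Ha; first by move: ay; rewrite leqn0 => /andP[/eqP ->].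
have [->//|az] := eqVneq a z.+1.
have Hz : Tl a + T z <= Tl z + T a.
  by apply: IH; [lia|lia|] => y ya; apply: Ha; lia.
case mz: (m z); last by rewrite !tcountS mz; lia.
case lz: (l z); first by rewrite !tcountS mz lz; lia.
have [i ai li] := C.2 z ltac:(lia) mz lz; have [iz mi _ H1 H2] := ai.
have Si := tcountS m i; have Sz := tcountS m z; rewrite mi mz in Si Sz.
have ai' : a <= i.
  rewrite leqNgt; apply/negP => ia.
  by have := H2 a ltac:(lia); have := Ha z.+1 ltac:(lia); rewrite /lower; lia.
have E1 : Tl a + T i <= Tl i + T a.
  by apply: IH; [lia|lia|] => y ya; apply: Ha; lia.
have E2 : Tl i.+1 + T z = Tl z + T i.+1 by apply: compatible_balanced => //; lia.
by move: E1 E2; rewrite !tcountS mi mz lz li; lia.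
Qed.

Lemma compatible_le x : x <= k -> T x <= Tl x.
Proof.
elim/ltn_ind: x => -[|z] IH zk; first by rewrite /tcount !big_ord0.
have Hz := IH z ltac:(lia) ltac:(lia).
case mz: (m z); last by rewrite !tcountS mz; lia.
case lz: (l z); first by rewrite !tcountS mz lz; lia.
have [i ai li] := C.2 z ltac:(lia) mz lz; have [iz mi _ H1 H2] := ai.
have E1 := IH i ltac:(lia) ltac:(lia).
have E2 : Tl i.+1 + T z = Tl z + T i.+1 by apply: compatible_balanced => //; lia.
by move: E2; rewrite !tcountS mi mz lz li; lia.
Qed.

End Compatible.
End Arcs.

(** * Dyck tilings *)

Section Nodes.
Variables f g : nat.
Notation k := (f + g).
Implicit Types (n u v z : node f g) (S : {set node f g}).

(* [nx] is the column, shifted so as to start at [0]; [nx] and [ny] together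
   determine a node. *)
Definition nx n : nat := n.2 + g - n.1.
Definition ny n : nat := n.2.

Lemma nx_le n : nx n <= k.
Proof. by have := ltn_ord n.1; have := ltn_ord n.2; rewrite /nx; lia. Qed.

Lemma nx_row n : nx n + n.1 = ny n + g.
Proof. by have := ltn_ord n.1; rewrite /nx /ny; lia. Qed.

Lemma node_inj u v : nx u = nx v -> ny u = ny v -> u = v.
Proof.
move=> ex ey; have := nx_row u; have := nx_row v; move: ex ey; rewrite /ny.
by case: u v => [a b] [c d] /= ? ? ? ?; congr pair; apply: val_inj => /=; lia.
Qed.

Lemma col_le u v : (Defs.col u <= Defs.col v)%R = (nx u <= nx v).
Proof.
have := nx_row u; have := nx_row v; rewrite /Defs.col /ny.
by move=> ? ?; apply/idP/idP; lia.
Qed.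

Lemma height_nx n : height n + nx n = 2 * ny n + g.
Proof. by have := nx_row n; rewrite /height /ny; lia. Qed.

Lemma isNE_nx u v : isNE u v = (nx v == (nx u).+1) && (ny v == (ny u).+1).
Proof. by have := nx_row u; have := nx_row v; rewrite /isNE /ny /=; lia. Qed.

Lemma isSE_nx u v : isSE u v = (nx v == (nx u).+1) && (ny v == ny u).
Proof. by have := nx_row u; have := nx_row v; rewrite /isSE /ny /=; lia. Qed.

Lemma isSW_nx u v : isSW u v = (nx u == (nx v).+1) && (ny u == (ny v).+1).
Proof. by have := nx_row u; have := nx_row v; rewrite /isSW /ny /=; lia. Qed.

Definition mkn (x b : nat) : node f g := (inord (b + g - x), inord b).

Lemma mkn_nx x b : b <= f -> b <= x <= b + g -> nx (mkn x b) = x.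
Proof. by move=> bf bx; rewrite /nx /= !inordK; lia. Qed.

Lemma mkn_ny x b : b <= f -> ny (mkn x b) = b.
Proof. by move=> bf; rewrite /ny /= inordK. Qed.

Lemma startP S u : reflect (u \in S /\ forall v, v \in S -> nx u <= nx v) (is_start S u).
Proof.
apply: (iffP andP) => -[uS H]; split=> //.
  by move=> v vS; rewrite -col_le; apply: (implyP (forallP H v)).
by apply/forallP => v; apply/implyP => vS; rewrite col_le; apply: H.
Qed.

Lemma endP S u : reflect (u \in S /\ forall v, v \in S -> nx v <= nx u) (is_end S u).
Proof.
apply: (iffP andP) => -[uS H]; split=> //.
  by move=> v vS; rewrite -col_le; apply: (implyP (forallP H v)).
by apply/forallP => v; apply/implyP => vS; rewrite col_le; apply: H.
Qed.

Lemma exists_start S u : u \in S -> exists v, is_start S v.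
Proof. by move=> uS; case: (arg_minnP nx uS) => v vS H; exists v; apply/startP. Qed.

Lemma exists_end S u : u \in S -> exists v, is_end S v.
Proof. by move=> uS; case: (arg_maxnP nx uS) => v vS H; exists v; apply/endP. Qed.

Lemma tile_nth S : is_tile S -> exists x0 N (e : nat -> node f g),
  [/\ forall z, z \in S <-> exists2 i, i < N & z = e i,
      forall i, i < N -> nx (e i) = x0 + i &
      forall i, i.+1 < N -> ny (e i.+1) = ny (e i) \/ ny (e i.+1) = (ny (e i)).+1].
Proof.
case/andP=> S0 /existsP[s /andP[srt /eqP SE]].
have [n1 n1S] := card_gt0P S0.
pose e i := nth n1 s i.
have sz : size s = #|S| by rewrite size_tuple.
have stp i : i.+1 < #|S| -> isNE (e i) (e i.+1) || isSE (e i) (e i.+1).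
  by move=> iS; have /(sortedP n1)/(_ i) := srt; rewrite sz; apply.
exists (nx (e 0)), #|S|, e; split=> [z|i|i iS].
- have -> : (z \in S) = (z \in tval s) by rewrite {1}SE inE.
  split=> [zs|[i iS ->]]; last by apply: mem_nth; rewrite sz.
  by exists (index z s); [move: zs; rewrite -index_mem sz | rewrite /e nth_index].
- elim: i => [|i IHi] iS; first by rewrite addn0.
  by have := stp i iS; rewrite isNE_nx isSE_nx IHi; lia.
- by have := stp i iS; rewrite isNE_nx isSE_nx; lia.
Qed.

Lemma tile_inj S u v : is_tile S -> u \in S -> v \in S -> nx u = nx v -> u = v.
Proof.
move=> /tile_nth[x0 [N [e [H1 H2 _]]]] /H1[i iN ->] /H1[j jN ->].
by rewrite !H2 // => ij; have -> : i = j by lia.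
Qed.

Lemma tile_contig S u v x : is_tile S -> u \in S -> v \in S -> nx u <= x <= nx v ->
  exists2 z, z \in S & nx z = x.
Proof.
move=> /tile_nth[x0 [N [e [H1 H2 _]]]] /H1[i iN ->] /H1[j jN ->].
rewrite !H2 // => ij; exists (e (x - x0)); last by rewrite H2; lia.
by apply/H1; exists (x - x0) => //; lia.
Qed.

Lemma tile_step S u v : is_tile S -> u \in S -> v \in S -> nx v = (nx u).+1 ->
  ny v = ny u \/ ny v = (ny u).+1.
Proof.
move=> /tile_nth[x0 [N [e [H1 H2 H3]]]] /H1[i iN ->] /H1[j jN ->].
by rewrite !H2 // => ij; have -> : j = i.+1 by [lia]; apply: H3; lia.
Qed.

End Nodes.

(* [lia] splits on every boolean hypothesis, arithmetical or not. *)
Ltac natlia :=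
  repeat match goal with
  | H : is_true (in_mem _ _) |- _ => clear H
  | H : is_true (is_part _) |- _ => clear H
  | H : is_true (is_tile _) |- _ => clear H
  | H : is_true (dyck_tiling _ _) |- _ => clear H
  | H : is_true (cover_expansive _ _) |- _ => clear H
  | H : is_true (subset _ _) |- _ => clear H
  end; lia.

Section Tilings.
Variables (f g : nat) (lam mu : g.-tuple 'I_f.+1).
Hypotheses (lamP : is_part lam) (muP : is_part mu).
Notation k := (f + g).
Notation wm := (pword g (part mu)).
Notation wl := (pword g (part lam)).
Notation Tm := (tcount wm).
Notation Tl := (tcount wl).
Notation R := (diagram lam :\: diagram mu).
Implicit Types (n u v z : node f g) (S : {set node f g}).

Lemma tcount_word_bounds (l : g.-tuple 'I_f.+1) x : is_part l -> x <= k ->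
  [/\ tcount (pword g (part l)) x <= x, x <= tcount (pword g (part l)) x + g
    & tcount (pword g (part l)) x <= f].
Proof.
move=> /parts_of_tuple lP xk; have := tcount_pword lP x.
have : \sum_(r < g) (part l r + (g - r.+1) < x) <= g.
  rewrite -[X in _ <= X]muln1 -[X in _ <= X * _](card_ord g) -sum_nat_const.
  by apply: leq_sum => r _; case: (_ < _).
have := tcount_pword_end lP; have := tcount_le (pword g (part l)) xk.
by move=> *; split; natlia.
Qed.

Lemma mem_diagram (l : g.-tuple 'I_f.+1) n : is_part l ->
  (n \in diagram l) = [&& 0 < n.1, 0 < n.2 & ny n <= tcount (pword g (part l)) (nx n)].
Proof.
move=> /parts_of_tuple lP; rewrite inE; case: (posnP n.1) => //= n1; congr (_ && _).
by rewrite (diagram_tcount lP) //; have := ltn_ord n.1; natlia.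
Qed.

Lemma mem_R n : (n \in R) = (Tm (nx n) < ny n <= Tl (nx n)).
Proof.
rewrite inE !mem_diagram //.
(* Nodes with a zero coordinate drop out by themselves: in row zero [ny n] is [nx n - g], which
   never exceeds [Tm (nx n)]. *)
have [_ + _] := tcount_word_bounds muP (nx_le n).
have := nx_row n; rewrite /ny; case: (nat_of_ord n.1) (nat_of_ord n.2) => [|a] [|b] //=; natlia.
Qed.

Lemma node_R x b : x <= k -> Tm x < b <= Tl x ->
  exists n, [/\ n \in R, nx n = x & ny n = b].
Proof.
move=> xk bx; have [? ? ?] := tcount_word_bounds muP xk.
have [? ? ?] := tcount_word_bounds lamP xk.
have e1 : nx (mkn f g x b) = x by apply: mkn_nx; natlia.
have e2 : ny (mkn f g x b) = b by apply: mkn_ny; natlia.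
by exists (mkn f g x b); rewrite mem_R e1 e2.
Qed.

Lemma tcount_subset : diagram mu \subset diagram lam -> forall x, x <= k -> Tm x <= Tl x.
Proof.
move=> /subsetP sub x xk; rewrite leqNgt; apply/negP => lt.
have [? ? ?] := tcount_word_bounds muP xk.
have [? ? ?] := tcount_word_bounds lamP xk.
have e1 : nx (mkn f g x (Tm x)) = x by apply: mkn_nx; natlia.
have e2 : ny (mkn f g x (Tm x)) = Tm x by apply: mkn_ny; natlia.
have := sub (mkn f g x (Tm x)); rewrite !mem_diagram // e1 e2 leqnn.
have := nx_row (mkn f g x (Tm x)); rewrite e1 e2.
move: e2 lt; rewrite /ny => -> lt n1.
have -> : 0 < (mkn f g x (Tm x)).1 by move: n1; natlia.
have -> : 0 < tcount (pword g (part mu)) x by natlia.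
by move=> /(_ isT) /=; rewrite leqNgt lt.
Qed.

Lemma subset_tcount : (forall x, x <= k -> Tm x <= Tl x) -> diagram mu \subset diagram lam.
Proof.
move=> H; apply/subsetP => n; rewrite !mem_diagram // => /and3P[-> -> le] /=.
by apply: leq_trans le (H _ (nx_le n)).
Qed.

Definition flat (i j l : nat) : {set node f g} :=
  [set n | (i < nx n <= j) && (ny n == Tm (nx n) + l)].

(** One tile for each exchanged arc, indexed by its closing end [j]; the head of the stack is the
    opening end. The level is the full gap [Tl - Tm] at [j], so the tile lies along the path of
    [lam] there. *)
Definition arc_tiling : {set {set node f g}} :=
  [set flat (head 0 (openpos wm j)) j (Tl j - Tm j) | j : 'I_k & wm j && ~~ wl j].

(** * A cover-expansive tiling forces compatibility and is unique *)

Section FromTiling.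
Variable T : {set {set node f g}}.
Hypotheses (TT : dyck_tiling T R) (TC : cover_expansive T R).
Hypothesis sub : diagram mu \subset diagram lam.

Notation blk := (pblock T).

Lemma blk_self n : n \in R -> n \in blk n.
Proof. by move: TT => /andP[/and3P[/eqP cT _ _] _] nR; rewrite mem_pblock cT. Qed.

Lemma blk_T n : n \in R -> blk n \in T.
Proof. by move: TT => /andP[/and3P[/eqP cT _ _] _] nR; rewrite pblock_mem // cT. Qed.

Lemma blk_same n z : n \in R -> z \in blk n -> z \in R /\ blk z = blk n.
Proof.
move=> nR zn; move: TT => /andP[/and3P[/eqP cT tT _] _]; split.
  by rewrite -cT; apply/bigcupP; exists (blk n) => //; apply: blk_T.
exact: def_pblock tT (blk_T nR) zn.
Qed.

Lemma blk_dyck n : n \in R -> is_dyck (blk n).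
Proof. by move=> nR; case/andP: TT => _ /forallP/(_ (blk n))/implyP; apply; apply: blk_T. Qed.

Lemma blk_tile n : n \in R -> is_tile (blk n).
Proof. by move=> /blk_dyck/and3P[]. Qed.

(** Cover-expansiveness compares only the starts; since tiles occupy consecutive columns, the tile
    of [y] then meets every column of the tile of [n] up to that of [n]. [blk_SW] is the mirror
    image. *)
Lemma blk_SE n y z : n \in R -> y \in R -> nx y = (nx n).+1 -> ny y = ny n ->
  z \in blk n -> nx z <= nx n -> exists2 n', n' \in blk y & nx n' = nx z.
Proof.
move=> nR yR ex ey zn zx.
have [u uP] := exists_start (blk_self yR); have [v vP] := exists_start (blk_self nR).
have : nx u <= nx v.
  rewrite -col_le; case/andP: TC => /forallP/(_ n)/implyP/(_ nR)/forallP/(_ y).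
  move=> /implyP/(_ yR)/implyP; rewrite isSE_nx ex ey !eqxx => /(_ isT).
  by move=> /forallP/(_ u)/forallP/(_ v)/implyP/(_ uP)/implyP/(_ vP).
case/startP: uP => uy _; case/startP: vP => vn /(_ _ zn) vz uv.
by apply: tile_contig uy (blk_self yR) _; [exact: blk_tile | natlia].
Qed.

Lemma blk_SW n y z : n \in R -> y \in R -> nx n = (nx y).+1 -> ny n = (ny y).+1 ->
  z \in blk n -> nx n <= nx z -> exists2 n', n' \in blk y & nx n' = nx z.
Proof.
move=> nR yR ex ey zn zx.
have [u uP] := exists_end (blk_self yR); have [v vP] := exists_end (blk_self nR).
have : nx v <= nx u.
  rewrite -col_le; case/andP: TC => _ /forallP/(_ n)/implyP/(_ nR)/forallP/(_ y).
  move=> /implyP/(_ yR)/implyP; rewrite isSW_nx ex ey !eqxx => /(_ isT).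
  by move=> /forallP/(_ u)/forallP/(_ v)/implyP/(_ uP)/implyP/(_ vP).
case/endP: uP => uy _; case/endP: vP => vn /(_ _ zn) vz uv.
by apply: tile_contig (blk_self yR) uy _; [exact: blk_tile | natlia].
Qed.

(* A tile that leaves its level forces, by cover-expansiveness, the tile
   directly below to do the same; this cannot go on down to level one. *)
Lemma flat_step u v : u \in R -> v \in blk u -> nx v = (nx u).+1 ->
  ny v = ny u + wm (nx u).
Proof.
move: {2}(ny u - Tm (nx u)) (leqnn (ny u - Tm (nx u))) => d.
elim: d u v => [|d IHd] u v du uR vu ex.
  by move: uR; rewrite mem_R; natlia.
have [vR vE] := blk_same uR vu.
have tu := blk_tile uR.
have stp := tile_step tu (blk_self uR) vu ex.
have := uR; have := vR; rewrite !mem_R ex !tcountS => vR' uR'.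
have uk : (nx u).+1 <= k by rewrite -ex nx_le.
case mu': (wm (nx u)) in vR' *.
(* The path rises while the tile stays. The southwest node [y] of [v] lies directly below [u]; its
   tile reaches the column of [v] and, by induction, rises onto [v]. So [y] and [u] share a tile and
   a column. *)
- case: stp => ey; last by natlia.
  have [y [yR yx yy]] := @node_R (nx u) (ny u).-1 ltac:(natlia) ltac:(natlia).
  have [n' n'y n'x] := blk_SW vR yR ltac:(natlia) ltac:(natlia) (blk_self vR) (leqnn _).
  have [n'R n'E] := blk_same yR n'y.
  have := IHd y n' ltac:(rewrite yx; natlia) yR n'y ltac:(natlia).
  rewrite yx mu' => n'ny.
  have e : n' = v by apply: node_inj; natlia.
  have yu : y \in blk u by rewrite -vE -e n'E blk_self.
  by have := tile_inj tu yu (blk_self uR) yx => e'; rewrite e' in yy; natlia.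
(* The path falls while the tile rises. The southeast node [y] of [u] lies directly below [v]; its
   tile comes either from [u], giving two nodes in one column, or from a lower level, where
   induction applies. *)
- case: stp => ey; first by natlia.
  have [y [yR yx yy]] := @node_R (nx u).+1 (ny u) ltac:(natlia) ltac:(rewrite !tcountS mu'; natlia).
  have [n' n'y n'x] := blk_SE uR yR yx yy (blk_self uR) (leqnn _).
  have [n'R n'E] := blk_same yR n'y.
  have yn' : y \in blk n' by rewrite n'E blk_self.
  have := tile_step (blk_tile n'R) (blk_self n'R) yn' ltac:(natlia).
  case=> n'ny; last first.
    by have := IHd n' y ltac:(rewrite n'x; natlia) n'R yn' ltac:(natlia); rewrite n'x mu'; natlia.
  have e : n' = u by apply: node_inj; natlia.
  have yu : y \in blk u by rewrite -e.
  by have e' := tile_inj tu yu vu ltac:(natlia); rewrite e' in yy; natlia.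
Qed.

Lemma flat_blk u v : u \in R -> v \in blk u -> ny u + Tm (nx v) = ny v + Tm (nx u).
Proof.
wlog: u v / nx u <= nx v => [W uR vu|].
  have [le|/ltnW le] := leqP (nx u) (nx v); first exact: W.
  have [vR vE] := blk_same uR vu.
  by have := W v u le vR ltac:(rewrite vE; exact: blk_self); natlia.
move: {2}(nx v - nx u) (leqnn (nx v - nx u)) => d.
elim: d v => [|d IHd] v dv uv uR vu.
  by have -> : u = v by apply: tile_inj (blk_self uR) vu _; [exact: blk_tile | natlia].
have [e|ne] := eqVneq (nx u) (nx v); first by apply: IHd => //; natlia.
have [z zu zx] := tile_contig (x := (nx v).-1) (blk_tile uR) (blk_self uR) vu ltac:(natlia).
have [zR zE] := blk_same uR zu.
have := IHd z ltac:(natlia) ltac:(natlia) uR zu.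
have := @flat_step z v zR ltac:(by rewrite zE) ltac:(natlia).
have -> : nx v = (nx z).+1 by natlia.
by rewrite tcountS; natlia.
Qed.

(** If the path of [mu] rose into the first column, the southwest node of the start would lie in the
    region and its tile would contain the start; dually at the end. The height conditions of an arc
    are those of a Dyck tile. *)
Lemma blk_flat n : n \in R -> exists i j l,
  [/\ 0 < l, is_arc k wm i j, i < nx n <= j, ny n = Tm (nx n) + l &
      (forall x, i < x <= j -> Tm x + l <= Tl x) /\ blk n = flat i j l].
Proof.
move=> nR; have nn := blk_self nR; have tn := blk_tile nR.
have [u uP] := exists_start nn; have [v vP] := exists_end nn.
have /and3P[_ /forallP/(_ u)/implyP/(_ uP)/forallP Hu /forallP/(_ v)/implyP/(_ vP)/forallP Hv]
  := blk_dyck nR.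
case/startP: uP => un umin; case/endP: vP => vn vmax.
have [uR uE] := blk_same nR un; have [vR vE] := blk_same nR vn.
have := nR; have := uR; have := vR; rewrite !mem_R => vR' uR' nR'.
(* The two paths meet in columns [0] and [k], so no tile touches these. *)
have u0 : 0 < nx u by case: posnP uR' => // ->; rewrite /tcount !big_ord0; natlia.
have vk : nx v < k.
  rewrite ltn_neqAle nx_le andbT; apply/eqP => e; move: vR'.
  by rewrite e !tcount_pword_end; [natlia | exact: parts_of_tuple..].
have lev z : z \in blk n -> ny z = Tm (nx z) + (ny n - Tm (nx n)).
  by move=> zn; have := flat_blk nR zn; natlia.
have inn x : nx u <= x <= nx v -> exists2 z, z \in blk n & nx z = x.
  exact: tile_contig tn un vn.
have uv := vmax u un.
have un1 := umin n nn; have nv1 := vmax n nn.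
exists (nx u).-1, (nx v), (ny n - Tm (nx n)); split; [natlia| |natlia|natlia|split].
- have i1 : (nx u).-1.+1 = nx u by natlia.
  split; first by natlia.
  + case mi: (wm (nx u).-1) => //; have S := tcountS wm (nx u).-1.
    have S' := tcountS wl (nx u).-1; rewrite mi i1 in S S'.
    have [y [yR yx yy]] := @node_R (nx u).-1 (ny u).-1 ltac:(natlia) ltac:(natlia).
    have [n' n'y n'x] := blk_SW uR yR ltac:(natlia) ltac:(natlia) (blk_self uR) (leqnn _).
    have [n'R n'E] := blk_same yR n'y.
    have e : n' = u.
      by apply: node_inj => //; have := flat_blk yR n'y; rewrite yx n'x; natlia.
    by have := umin y ltac:(by rewrite -uE -e n'E blk_self); natlia.
  + case mj: (wm (nx v)) => //; have S := tcountS wm (nx v).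
    have S' := tcountS wl (nx v); rewrite mj in S.
    have [y [yR yx yy]] := @node_R (nx v).+1 (ny v) ltac:(natlia) ltac:(natlia).
    have [n' n'y n'x] := blk_SE vR yR yx yy (blk_self vR) (leqnn _).
    have [n'R n'E] := blk_same yR n'y.
    have e : n' = v.
      by apply: node_inj => //; have := flat_blk yR n'y; rewrite yx n'x; natlia.
    by have := vmax y ltac:(by rewrite -vE -e n'E blk_self); natlia.
  + have := implyP (Hu v) vn; have := height_nx u; have := height_nx v.
    by have := lev u un; have := lev v vn; rewrite i1 /lower; natlia.
  + move=> y yi; have [z zn zx] := inn y ltac:(natlia); rewrite -zx.
    have := implyP (Hv z) zn; have := height_nx z; have := height_nx v.
    by have := lev z zn; have := lev v vn; rewrite /lower; natlia.
- move=> x xi; have [z zn zx] := inn x ltac:(natlia).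
  have [zR _] := blk_same nR zn; move: zR; rewrite mem_R zx.
  by have := lev z zn; rewrite zx; natlia.
- apply/setP => z; rewrite inE; apply/idP/andP => [zn|[zi /eqP zy]].
    by have := umin z zn; have := vmax z zn; have := lev z zn; split; [natlia | apply/eqP].
  have [z' z'n z'x] := inn (nx z) ltac:(natlia).
  by have -> : z = z' by apply: node_inj; rewrite ?(lev z' z'n) ?z'x ?zy.
Qed.

(** Nothing lies above the two end nodes: the start of a tile at level [l.+1] over the first column
    would force, by [blk_SW], a tile at level [l] to run from outside into this one; [blk_SE]
    handles the other end. *)
Lemma blk_top n i j l : n \in R -> 0 < l -> is_arc k wm i j ->
  (forall x, i < x <= j -> Tm x + l <= Tl x) -> blk n = flat i j l ->
  [/\ wl i = true, wl j = false, Tl i.+1 = Tm i.+1 + l & Tl j = Tm j + l].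
Proof.
move=> nR l0 [ij mi mj _ _] lR nE.
have in_n z : i < nx z <= j -> ny z = Tm (nx z) + l -> blk z = blk n.
  move=> zi zy; have zn : z \in blk n by rewrite nE inE zi zy eqxx.
  by have [] := blk_same nR zn.
have out z : z \in R -> blk z = blk n -> i < nx z <= j.
  by move=> zR zn; have := blk_self zR; rewrite zn nE inE => /andP[].
have Smi := tcountS wm i; have Smj := tcountS wm j; rewrite mi mj in Smi Smj.
have Sli := tcountS wl i; have Slj := tcountS wl j.
have li := lR i.+1 ltac:(natlia); have lj := lR j ltac:(natlia).
have E1 : Tl i.+1 = Tm i.+1 + l.
  apply/eqP; rewrite eqn_leq li andbT leqNgt; apply/negP => lt.
  have [p [pR px py]] := @node_R i.+1 (Tm i.+1 + l.+1) ltac:(natlia) ltac:(natlia).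
  have [i2 [j2 [l2 [l20 [ij2 mi2 mj2 _ _] ip yp [pl pE]]]]] := blk_flat pR.
  have l2E : l2 = l.+1 by rewrite px in yp; natlia.
  have S2 := tcountS wm i2; have S2' := tcountS wl i2; rewrite mi2 in S2.
  have lr2 := pl i2.+1 ltac:(natlia).
  have [u [uR ux uy]] := @node_R i2.+1 (Tm i2.+1 + l2) ltac:(natlia) ltac:(natlia).
  have up : u \in blk p by rewrite pE inE ux uy eqxx; natlia.
  have [_ uE] := blk_same pR up.
  have [y [yR yx yy]] := @node_R i2 (Tm i2 + l) ltac:(natlia) ltac:(natlia).
  have [n' n'y n'x] := @blk_SW u y p uR yR ltac:(natlia) ltac:(natlia)
     ltac:(by rewrite uE blk_self) ltac:(natlia).
  have [n'R n'E] := blk_same yR n'y; have := flat_blk yR n'y; rewrite yx yy => lvl.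
  have := in_n n' ltac:(natlia) ltac:(natlia); rewrite n'E => yn.
  by have := out y yR yn; natlia.
have E2 : Tl j = Tm j + l.
  apply/eqP; rewrite eqn_leq lj andbT leqNgt; apply/negP => lt.
  have [p [pR px py]] := @node_R j (Tm j + l.+1) ltac:(natlia) ltac:(natlia).
  have [i2 [j2 [l2 [l20 [ij2 mi2 mj2 _ _] ip yp [pl pE]]]]] := blk_flat pR.
  have l2E : l2 = l.+1 by rewrite px in yp; natlia.
  have S2 := tcountS wm j2; have S2' := tcountS wl j2; rewrite mj2 in S2.
  have lr2 := pl j2 ltac:(natlia).
  have [u [uR ux uy]] := @node_R j2 (Tm j2 + l2) ltac:(natlia) ltac:(natlia).
  have up : u \in blk p by rewrite pE inE ux uy eqxx; natlia.
  have [_ uE] := blk_same pR up.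
  have [y [yR yx yy]] := @node_R j2.+1 (Tm j2.+1 + l) ltac:(natlia) ltac:(natlia).
  have [n' n'y n'x] := @blk_SE u y p uR yR ltac:(natlia) ltac:(natlia)
     ltac:(by rewrite uE blk_self) ltac:(natlia).
  have [n'R n'E] := blk_same yR n'y; have := flat_blk yR n'y; rewrite yx yy => lvl.
  have := in_n n' ltac:(natlia) ltac:(natlia); rewrite n'E => yn.
  by have := out y yR yn; natlia.
split=> //.
(* Otherwise level [l] persists in column [i]; the tile there cannot end at [i], where [wm] is
   [false], so it runs into this tile. *)
- case lI: (wl i) in Sli *; first by []; exfalso.
  have [y [yR yx yy]] := @node_R i (Tm i + l) ltac:(natlia) ltac:(natlia).
  have [i2 [j2 [l2 [l20 [ij2 mi2 mj2 _ _] iy yl [pl yE]]]]] := blk_flat yR.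
  have l2E : l2 = l by rewrite yx in yl; natlia.
  have [j2i|j2i] := eqVneq j2 i; first by rewrite j2i mi in mj2.
  have [u [uR ux uy]] := @node_R i.+1 (Tm i.+1 + l) ltac:(natlia) ltac:(natlia).
  have uy' : u \in blk y by rewrite yE inE ux uy l2E eqxx; natlia.
  have [_ uE] := blk_same yR uy'.
  have := in_n u ltac:(natlia) ltac:(rewrite ux; natlia); rewrite uE => yn.
  by have := out y yR yn; natlia.
- case lJ: (wl j) in Slj *; last by []; exfalso.
  have [y [yR yx yy]] := @node_R j.+1 (Tm j.+1 + l) ltac:(natlia) ltac:(natlia).
  have [i2 [j2 [l2 [l20 [ij2 mi2 mj2 _ _] iy yl [pl yE]]]]] := blk_flat yR.
  have l2E : l2 = l by rewrite yx in yl; natlia.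
  have [i2j|i2j] := eqVneq i2 j; first by rewrite i2j mj in mi2.
  have [u [uR ux uy]] := @node_R j (Tm j + l) ltac:(natlia) ltac:(natlia).
  have uy' : u \in blk y by rewrite yE inE ux uy l2E eqxx; natlia.
  have [_ uE] := blk_same yR uy'.
  have := in_n u ltac:(natlia) ltac:(rewrite ux; natlia); rewrite uE => yn.
  by have := out y yR yn; natlia.
Qed.

(** The top node of column [i.+1] has a level exceeding the gap [Tl - Tm] at [i], so its tile starts
    right there. *)
Lemma blk_at_open i : i < k -> wm i = false -> wl i = true ->
  exists2 j, is_arc k wm i j & wl j = false.
Proof.
move=> ik mi li.
have Sm := tcountS wm i; have Sl := tcountS wl i; rewrite mi li in Sm Sl.
have le := tcount_subset sub (ltnW ik).
have [n [nR nX nY]] := @node_R i.+1 (Tl i.+1) ltac:(natlia) ltac:(natlia).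
have [i2 [j2 [l2 [l20 a ni yl [nl nE]]]]] := blk_flat nR.
have [_ lj _ _] := blk_top nR l20 a nl nE.
suff -> : i = i2 by exists j2.
apply/eqP/negPn/negP => ne; have := nl i ltac:(natlia); rewrite nX in yl; natlia.
Qed.

Lemma blk_at_close j : j < k -> wm j = true -> wl j = false ->
  exists n i, [/\ n \in R, is_arc k wm i j, wl i = true & blk n = flat i j (Tl j - Tm j)].
Proof.
move=> jk mj lj.
have Sm := tcountS wm j; have Sl := tcountS wl j; rewrite mj lj in Sm Sl.
have le := tcount_subset sub jk.
have [n [nR nX nY]] := @node_R j (Tl j) ltac:(natlia) ltac:(natlia).
have [i2 [j2 [l2 [l20 a ni yl [nl nE]]]]] := blk_flat nR.
have [li _ _ E] := blk_top nR l20 a nl nE.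
have e : j = j2.
  apply/eqP/negPn/negP => ne; have := nl j.+1 ltac:(natlia); rewrite nX in yl; natlia.
exists n, i2; split; rewrite ?e //; rewrite nE; congr flat; natlia.
Qed.

Lemma tiling_compatible : compatible k wm wl.
Proof.
split=> [i|j jk mj lj]; first exact: blk_at_open.
by have [n [i [_ a li _]]] := blk_at_close jk mj lj; exists i.
Qed.

Lemma tiling_unique : T = arc_tiling.
Proof.
apply/setP => S; apply/idP/imsetP => [ST|[j]]; last first.
  rewrite inE => /andP[mj lj] ->.
  have [n [i [nR a li E]]] := blk_at_close (ltn_ord j) mj (negbTE lj).
  by have [s ->] := arc_openpos a; rewrite /= -E; apply: blk_T.
have /andP[/and3P[/eqP cT tT T0] _] := TT.
have [n nS] : exists n, n \in S.
  by apply/set0Pn; apply: contraNneq T0 => <-.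
have nR : n \in R by rewrite -cT; apply/bigcupP; exists S.
have <- : blk n = S by apply: def_pblock.
have [i [j [l [l0 a ni yl [nl nE]]]]] := blk_flat nR.
have [li lj _ E] := blk_top nR l0 a nl nE.
have [jk _ mj _ _] := a; have jk' : j < k by natlia.
exists (Ordinal jk'); first by rewrite inE /= mj lj.
have [s ->] := arc_openpos a.
by rewrite nE /=; congr flat; natlia.
Qed.

End FromTiling.

(** * Compatible words give a cover-expansive tiling *)

Section FromCompatible.
Hypothesis C : compatible k wm wl.

Lemma arc_tilingI i j : is_arc k wm i j -> wl j = false ->
  flat i j (Tl j - Tm j) \in arc_tiling.
Proof.
move=> a lj; have [ij _ mj _ _] := a; have jk : j < k by natlia.
apply/imsetP; exists (Ordinal jk); first by rewrite inE /= mj lj.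
by have [s ->] := arc_openpos a.
Qed.

(** The last two inequalities make the tile a maximal run of columns with gap at least [l];
    disjointness and cover-expansiveness rest on this maximality. *)
Lemma arc_tilingP S : S \in arc_tiling -> exists i j l,
  [/\ is_arc k wm i j, 0 < l, S = flat i j l, (forall x, i < x <= j -> Tm x + l <= Tl x)
    & Tl i < Tm i + l /\ Tl j.+1 < Tm j.+1 + l].
Proof.
case/imsetP=> j; rewrite inE => /andP[mj lj] ->.
have [i a li] := C.2 j (ltn_ord j) mj (negbTE lj).
have [s ->] := arc_openpos a; have [ij mi _ H1 H2] := a.
have E : Tl i.+1 + Tm j = Tl j + Tm i.+1 by apply: (compatible_balanced C) => //; natlia.
have mono y : i < y <= j -> Tl i.+1 + Tm y <= Tl y + Tm i.+1.
  move=> yi; apply: (compatible_mono C) => [|z zy]; first by natlia.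
  by have := H2 z ltac:(natlia); move: H1; rewrite /lower; natlia.
have le := compatible_le C (x := i) ltac:(natlia).
have Sm := tcountS wm i; have Sl := tcountS wl i; rewrite mi li in Sm Sl.
exists i, j, (Tl j - Tm j); split=> //; first by natlia.
  by move=> x xi; have := mono x xi; natlia.
by rewrite !tcountS mj (negbTE lj); natlia.
Qed.

Lemma flat_node i j l x : is_arc k wm i j -> 0 < l ->
  (forall y, i < y <= j -> Tm y + l <= Tl y) -> i < x <= j ->
  exists n, [/\ n \in R, n \in flat i j l & nx n = x].
Proof.
move=> [ij _ _ _ _] l0 lR xi; have := lR x xi => lx.
have [n [nR nX nY]] := @node_R x (Tm x + l) ltac:(natlia) ltac:(natlia).
by exists n; split=> //; rewrite inE nX nY xi eqxx.
Qed.

Lemma flat_is_tile i j l : is_arc k wm i j -> 0 < l ->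
  (forall y, i < y <= j -> Tm y + l <= Tl y) -> is_tile (flat i j l).
Proof.
move=> a l0 lR; have [ij _ _ _ _] := a.
pose e x := mkn f g x (Tm x + l).
have eP x : i < x <= j -> nx (e x) = x /\ ny (e x) = Tm x + l.
  move=> xi; have [n [nR]] := flat_node a l0 lR xi.
  rewrite inE => /andP[_ /eqP nY] nX; rewrite nX in nY.
  have xk : x <= k by natlia.
  have [? ? ?] := tcount_word_bounds lamP xk; have [? ? ?] := tcount_word_bounds muP xk.
  have := lR x xi; rewrite /e => lx.
  by rewrite mkn_nx ?mkn_ny //; natlia.
pose s := [seq e x | x <- iota i.+1 (j - i)].
have sS : flat i j l = [set x in s].
  apply/setP => z; rewrite !inE; apply/andP/mapP => [[zi /eqP zy]|[x]].
    exists (nx z); first by rewrite mem_iota; natlia.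
    by have [e1 e2] := eP (nx z) zi; apply: node_inj; rewrite ?e1 ?e2.
  rewrite mem_iota => xi ->; have [-> ->] := eP x ltac:(natlia).
  by rewrite eqxx; split=> //; natlia.
have us : uniq s.
  rewrite map_inj_in_uniq ?iota_uniq // => x y; rewrite !mem_iota => xi yi exy.
  by have [<- _] := eP x ltac:(natlia); have [<- _] := eP y ltac:(natlia); rewrite exy.
have sz : size s == #|flat i j l| by rewrite sS cardsE (card_uniqP us).
apply/andP; split; first by rewrite -(eqP sz) size_map size_iota; natlia.
apply/existsP; exists (Tuple sz) => /=; rewrite -sS eqxx andbT.
apply/(sortedP (e 0)) => x; rewrite size_map size_iota => xs.
rewrite !(nth_map 0) ?size_iota //; try natlia.
rewrite !nth_iota; try natlia.
have [e1 e2] := eP (i.+1 + x) ltac:(natlia); have [e3 e4] := eP (i.+1 + x.+1) ltac:(natlia).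
rewrite isNE_nx isSE_nx e1 e2 e3 e4 addnS tcountS.
by case: (wm _); natlia.
Qed.

Lemma flat_start i j l u : is_arc k wm i j -> 0 < l ->
  (forall y, i < y <= j -> Tm y + l <= Tl y) -> is_start (flat i j l) u -> nx u = i.+1.
Proof.
move=> a l0 lR /startP[uS umin]; have [ij _ _ _ _] := a.
have [n [_ nS nX]] := flat_node (x := i.+1) a l0 lR ltac:(natlia).
by have := umin n nS; move: uS; rewrite inE; natlia.
Qed.

Lemma flat_end i j l u : is_arc k wm i j -> 0 < l ->
  (forall y, i < y <= j -> Tm y + l <= Tl y) -> is_end (flat i j l) u -> nx u = j.
Proof.
move=> a l0 lR /endP[uS umax]; have [ij _ _ _ _] := a.
have [n [_ nS nX]] := flat_node (x := j) a l0 lR ltac:(natlia).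
by have := umax n nS; move: uS; rewrite inE; natlia.
Qed.

Lemma flat_is_dyck i j l : is_arc k wm i j -> 0 < l ->
  (forall y, i < y <= j -> Tm y + l <= Tl y) -> is_dyck (flat i j l).
Proof.
move=> a l0 lR; have [ij mi mj H1 H2] := a.
apply/and3P; split; first exact: flat_is_tile.
  apply/forallP => u; apply/implyP => uP; have ux := flat_start a l0 lR uP.
  case/startP: uP; rewrite inE => /andP[ui /eqP uy] _.
  apply/forallP => z; apply/implyP; rewrite inE => /andP[zi /eqP zy].
  have := H2 (nx z) zi; have := height_nx z; have := height_nx u; move: H1.
  by rewrite /lower zy uy ux; natlia.
apply/forallP => u; apply/implyP => uP; have ux := flat_end a l0 lR uP.
case/endP: uP; rewrite inE => /andP[ui /eqP uy] _.
apply/forallP => z; apply/implyP; rewrite inE => /andP[zi /eqP zy].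
have := H2 (nx z) zi; have := height_nx z; have := height_nx u.
by rewrite /lower zy uy ux; natlia.
Qed.

Lemma arc_tiling_cover n : n \in R -> exists2 S, S \in arc_tiling & n \in S.
Proof.
rewrite mem_R => nR; have nk := nx_le n.
pose l := ny n - Tm (nx n).
(* The last column before [n] whose gap is below the level of [n]. The gap grows there, so [wm i] is
   [false] and [wl i] is [true]: an exchanged arc opens at [i]. *)
have [i [ix il Hi]] : exists i, [/\ i < nx n, Tl i < Tm i + l &
    forall y, i < y <= nx n -> Tm y + l <= Tl y].
  pose P := [pred i | (i < nx n) && (Tl i < Tm i + l)].
  have P0 : exists i, P i.
    exists 0; rewrite /= /tcount !big_ord0 /l; case: posnP => [e|_] /=; last by natlia.
    by move: nR; rewrite e /tcount !big_ord0; natlia.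
  have Pub i : P i -> i <= nx n by case/andP=> /ltnW.
  case: (ex_maxnP P0 Pub) => i /andP[i1 i2] imax; exists i; split=> // y yi.
  rewrite leqNgt; apply/negP => ly; have [yx|yx] := eqVneq y (nx n).
    by move: ly; rewrite yx /l; natlia.
  by have := imax y; rewrite /= ly andbT; natlia.
have Sm := tcountS wm i; have Sl := tcountS wl i; have Hi1 := Hi i.+1 ltac:(natlia).
case mi: (wm i) in Sm; first by case: (wl i) in Sl; natlia.
case li: (wl i) in Sl; last by natlia.
have [j a lj] := C.1 i ltac:(natlia) mi li; have [ij _ mj H1 H2] := a.
have E : Tl i.+1 + Tm j = Tl j + Tm i.+1 by apply: (compatible_balanced C) => //; natlia.
exists (flat i j (Tl j - Tm j)); first exact: arc_tilingI.
have Smj := tcountS wm j; have Slj := tcountS wl j; rewrite mj lj in Smj Slj.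
have jx : nx n <= j by rewrite leqNgt; apply/negP => xj; have := Hi j.+1 ltac:(natlia); natlia.
by rewrite inE; apply/andP; split; [natlia | apply/eqP; rewrite /l in il Hi1; natlia].
Qed.

Lemma arc_tiling_ok : dyck_tiling arc_tiling R /\ cover_expansive arc_tiling R.
Proof.
have triv : trivIset arc_tiling.
  apply/trivIsetP => S1 S2 /arc_tilingP[i [j [l [a l0 -> lR [hi hj]]]]].
  move=> /arc_tilingP[i' [j' [l' [a' l0' -> lR' [hi' hj']]]]].
  apply: contraNT => /pred0Pn[z /andP[]]; rewrite !inE => /andP[zi /eqP zy] /andP[zi' /eqP zy'].
  (* A common node has one level, and two maximal runs of the same level that meet coincide. *)
  have ll : l' = l by natlia.
  have ii : i = i'.
    have [ii|ii|//] := ltngtP i i'; first by have := lR i' ltac:(natlia); natlia.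
    by have := lR' i ltac:(natlia); natlia.
  by rewrite ii in a *; rewrite ll (arc_injR a a').
have cov : cover arc_tiling = R.
  apply/setP => n; apply/bigcupP/idP => [[S]|nR]; last first.
    by have [S ST nS] := arc_tiling_cover nR; exists S.
  move=> /arc_tilingP[i [j [l [a l0 -> lR [hi hj]]]]]; rewrite inE => /andP[ni /eqP nY].
  by rewrite mem_R nY; have := lR (nx n) ni; natlia.
have n0 : set0 \notin arc_tiling.
  apply/negP => /arc_tilingP[i [j [l [a l0 e lR _]]]]; have [ij _ _ _ _] := a.
  by have [n [_]] := flat_node (x := j) a l0 lR ltac:(natlia); rewrite -e inE.
split.
  apply/andP; split; first by apply/and3P; split=> //; apply/eqP.
  apply/forallP => S; apply/implyP => /arc_tilingP[i [j [l [a l0 -> lR _]]]].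
  exact: flat_is_dyck.
have blkP n : n \in R -> exists i j l,
  [/\ is_arc k wm i j, 0 < l, pblock arc_tiling n = flat i j l,
      (forall x, i < x <= j -> Tm x + l <= Tl x)
    & [/\ Tl i < Tm i + l, Tl j.+1 < Tm j.+1 + l, i < nx n <= j & ny n = Tm (nx n) + l]].
  move=> nR; have [S ST nS] := arc_tiling_cover nR.
  rewrite (def_pblock triv ST nS).
  have [i [j [l [a l0 e lR [hi hj]]]]] := arc_tilingP ST; exists i, j, l.
  by move: nS; rewrite e inE => /andP[ni /eqP nY].
apply/andP; split; apply/forallP => n; apply/implyP => nR; apply/forallP => y;
  apply/implyP => yR; apply/implyP; rewrite ?isSE_nx ?isSW_nx => /andP[/eqP ex /eqP ey];
  apply/forallP => u; apply/forallP => v; apply/implyP => uP; apply/implyP => vP;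
  rewrite col_le; move: uP vP.
(* A step to the southeast or southwest never raises the level, so the gap cannot drop below the
   level of [y] inside the run of [n]. *)
- have [i [j [l [a l0 -> lR [hi hj ni nY]]]]] := blkP n nR.
  have [i' [j' [l' [a' l0' -> lR' [hi' hj' ni' nY']]]]] := blkP y yR.
  move=> /(flat_start a' l0' lR') -> /(flat_start a l0 lR) ->.
  have := tcountS wm (nx n); rewrite ex in nY' ni' => S.
  rewrite ltnS leqNgt; apply/negP => ii.
  by have := lR i' ltac:(natlia); natlia.
- have [i [j [l [a l0 -> lR [hi hj ni nY]]]]] := blkP n nR.
  have [i' [j' [l' [a' l0' -> lR' [hi' hj' ni' nY']]]]] := blkP y yR.
  move=> /(flat_end a' l0' lR') -> /(flat_end a l0 lR) ->.
  have := tcountS wm (nx y); rewrite ex in nY ni => S.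
  rewrite leqNgt; apply/negP => jj.
  by have := lR j'.+1 ltac:(natlia); case: (wm _) in S; natlia.
Qed.

End FromCompatible.

Lemma ecoef_flips : ecoef lam mu = flips wm wl k 0 [::] :> nat.
Proof.
rewrite /ecoef; case: ifPn => [sub|nsub]; last first.
  (* Exchanges only move letters [true] to the left, so an accepted word has its path weakly above
     that of [mu]. *)
  case fl: (flips wm wl k 0 [::]) => //; case/negP: nsub; apply: subset_tcount.
  by move/flipsP: fl => C x; apply: (compatible_le C).
case fl: (flips wm wl k 0 [::]).
  move/flipsP: fl => C; apply/eqP/cards1P; exists arc_tiling; apply/setP => T.
  rewrite !inE; apply/andP/eqP => [[TT TC]|->]; first exact: tiling_unique.
  exact: arc_tiling_ok.
apply/eqP; rewrite cards_eq0; apply/eqP/setP => T; rewrite !inE; apply/negP => /andP[TT TC].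
by move/negP: fl; apply; apply/flipsP; apply: tiling_compatible TT TC sub.
Qed.

End Tilings.

Lemma psize_sum (f g : nat) (l : g.-tuple 'I_f.+1) : psize l = \sum_(r < g) part l r.
Proof.
rewrite /psize (big_nth ord0) size_tuple big_mkord; apply: eq_bigr => r _.
by rewrite /part (nth_map ord0) ?size_tuple.
Qed.

Lemma sign_psize (F : fieldType) (f g : nat) (lam mu : g.-tuple 'I_f.+1) :
  is_part lam -> is_part mu ->
  ((-1) ^+ (fsum (f + g) (pword g (part lam)) + fsum (f + g) (pword g (part mu))) =
   (-1) ^+ (psize lam + psize mu) :> F)%R.
Proof.
move=> /parts_of_tuple lP /parts_of_tuple mP.
(* The constant in [fsum_pword] occurs once for each partition, hence twice, and drops out of the
   parity. *)
rewrite (fsum_pword lP) (fsum_pword mP) -!psize_sum addnACA addnn.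
by rewrite -signr_odd oddD odd_double addbF signr_odd.
Qed.

Theorem theorem5p2 (F : fieldType) (f g : nat) (mu : g.-tuple 'I_f.+1) :
  is_part mu ->
  kills_m F f g
    (sword F mu -
     \sum_(lam : g.-tuple 'I_f.+1 | is_part lam)
        gscale ((-1) ^+ (psize lam + psize mu) * (ecoef lam mu)%:R) (tword F lam))%R.
Proof.
move=> muP; apply: kills_m_wcoef => h.
have [lam lamP lamE] := partition_of_word h.
(* Each [t] word contributes to a single word, so only the partition of the chosen word survives in
   the sum. *)
rewrite -(@eq_wcoef F f g _ _ _ lamE) wcoefB wcoef_sum (bigD1 lam) //= big1 ?addr0.
  rewrite wcoefZ wcoef_sword // wcoef_tword // sign_psize // ecoef_flips //.
  have -> : [forall a : 'I_(f + g), pword g (part lam) a == pword g (part lam) a].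
    by apply/forallP.
  by rewrite mulr1 subrr.
move=> nu /andP[nuP nl]; rewrite wcoefZ wcoef_tword //.
case: forallP => [e|_]; last by rewrite mulr0.
case/eqP: nl; apply: eq_from_tnth => r; apply: val_inj.
have := pword_inj (parts_of_tuple nuP) (parts_of_tuple lamP) _ (ltn_ord r).
rewrite /part !(nth_map ord0) ?size_tuple // -!tnth_nth; apply=> x xk.
exact: eqP (e (Ordinal xk)).
Qed.
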